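(* Let $X$, $Y$ be Banach spaces, let $G\in L(X,Y)$ be a norm-one operator, let $\mathcal{B}\subset B_X$ with $B_X=\overline{\operatorname{conv}}(\mathcal{B})$ and let $\mathcal{A}\subset B_{Y^*}$ with $\overline{\operatorname{conv}}^{w^*}(\mathcal{A})=B_{Y^*}$. The following assertions are equivalent: (i) $G$ has the alternative Daugavet property. (ii) $G(S)$ is a spear set of $Y$ for every slice $S$ of $\mathcal{B}$. (ii$^*$) $G^*(S^* )$ is a spear set of $X^*$ for every weak$^*$-slice $S^*$ of $\mathcal{A}$. (iii) For every $y_0\in S_Y$ and $\varepsilon>0$, $$B_X=\overline{\operatorname{conv}}\bigl(\{x\in\mathcal{B}: \sup_{\omega\in\mathbb{T}}\|Gx+\omega y_0\|>2-\varepsilon\}\bigr).$$ (iv) For every $x_0^*\in X^*$, the set $$\bigl\{y^*\in\operatorname{ext}B_{Y^*}: \sup_{\omega\in\mathbb{T}}\|G^*y^*+\omega x_0^*\|=1+\|x_0^*\|\bigr\}$$ is a dense $G_\delta$ set in $(\operatorname{ext}B_{Y^*},w^* )$.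
   Context: Scalars are $\mathbb{K}=\mathbb{R}$ or $\mathbb{C}$; $\mathbb{T}=\{\omega\in\mathbb{K}:|\omega|=1\}$; $B_X$, $S_X$ are the closed unit ball and unit sphere; $\operatorname{ext}$ denotes the set of extreme points. $G\in L(X,Y)$ has the alternative Daugavet property if $\sup_{\omega\in\mathbb{T}}\|G+\omega T\|=1+\|T\|$ for every rank-one $T\in L(X,Y)$. A set $F\subset B_Z$ in a Banach space $Z$ is a spear set if $\sup\{\|f+\omega z\|:f\in F,\ \omega\in\mathbb{T}\}=1+\|z\|$ for every $z\in Z$. A slice of a bounded set $A\subset X$ is a set of the form $\{x\in A:\operatorname{Re}x^*(x)>\sup_A\operatorname{Re}x^*-\alpha\}$ with $x^*\in X^*$, $\alpha>0$; a weak$^*$-slice of a bounded set $A\subset Y^*$ is a set $\{y^*\in A:\operatorname{Re}y^*(y)>\sup_{a^*\in A}\operatorname{Re}a^*(y)-\alpha\}$ with $y\in Y$, $\alpha>0$. *)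

(* Defs.v *)
From HB Require Import structures.
From mathcomp Require Import all_boot all_order all_algebra.
From mathcomp Require Import complex.
From mathcomp Require Import all_classical all_reals all_analysis.

Set Implicit Arguments.
Unset Strict Implicit.
Unset Printing Implicit Defensive.

Import Order.TTheory GRing.Theory Num.Theory.
Import numFieldNormedType.Exports.

Local Open Scope classical_set_scope.
Local Open Scope ring_scope.

(* The field of scalars is the reals if [cplx] is false, the complex numbers if
   [cplx] is true.  Norms of a [normedModType (scalar_field R cplx)] take values
   in the nonnegative (hence real) elements of the field; [rnorm] reads them in
   [R], where suprema can be taken. *)
Definition scalar_field (R : realType) (cplx : bool) : numFieldType :=
  if cplx then (R[i] : numFieldType) else (R : numFieldType).

Definition re_part (R : realType) (cplx : bool) : scalar_field R cplx -> R :=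
  match cplx with true => @complex.Re R | false => id end.

Definition of_real (R : realType) (cplx : bool) : R -> scalar_field R cplx :=
  match cplx with true => fun r => (r%:C)%C | false => id end.

Definition rnorm (R : realType) (cplx : bool)
    (V : normedModType (scalar_field R cplx)) (x : V) : R := re_part `|x|.

Section scalar_theory.
Context {R : realType} {cplx : bool}.
Local Notation K := (scalar_field R cplx).
Implicit Types (r s : R) (z : K).

Lemma of_realK r : re_part (of_real cplx r) = r.
Proof. by case: cplx. Qed.

Lemma reK z : 0 <= z -> of_real cplx (re_part z) = z.
Proof. by case: cplx z => //= -[a b]; rewrite lecE /= => /andP[/eqP ->]. Qed.

Lemma le_of_real r s : (of_real cplx r <= of_real cplx s) = (r <= s).
Proof. by case: cplx => //=; rewrite lecR. Qed.

Lemma of_real0 : of_real cplx 0 = 0 :> K.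
Proof. by case: cplx. Qed.

Lemma of_realD r s : of_real cplx (r + s) = of_real cplx r + of_real cplx s.
Proof. by case: cplx => //=; rewrite rmorphD. Qed.

Lemma of_realM r s : of_real cplx (r * s) = of_real cplx r * of_real cplx s.
Proof. by case: cplx => //=; rewrite rmorphM. Qed.

Lemma of_real1 : of_real cplx 1 = 1 :> K.
Proof. by case: cplx. Qed.

Lemma le_re z1 z2 : z1 <= z2 -> re_part z1 <= re_part z2.
Proof.
by case: cplx z1 z2 => //= -[a b] [c d]; rewrite lecE /= => /andP[].
Qed.

Lemma of_rnorm (V : normedModType K) (x : V) : of_real cplx (rnorm x) = `|x|.
Proof. exact: reK. Qed.

Lemma rnorm_ge0 (V : normedModType K) (x : V) : 0 <= rnorm x.
Proof. by rewrite -le_of_real of_rnorm of_real0. Qed.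

Lemma rnormD (V : normedModType K) (x y : V) :
  rnorm (x + y) <= rnorm x + rnorm y.
Proof. by rewrite -le_of_real of_realD !of_rnorm ler_normD. Qed.

Lemma rnormZ (V : normedModType K) (a : K) (x : V) :
  rnorm (a *: x) = re_part `|a| * rnorm x.
Proof.
by apply: (can_inj of_realK); rewrite of_realM !of_rnorm normrZ ?reK.
Qed.

End scalar_theory.

Section sets.
Context {R : realType} {cplx : bool}.
Local Notation K := (scalar_field R cplx).

Definition unimodular : set K := [set w | `|w| = 1].

Definition unit_ball (V : normedModType K) : set V := [set x | `|x| <= 1].

Definition unit_sphere (V : normedModType K) : set V := [set x | `|x| = 1].

End sets.
Arguments unit_ball {R cplx} V.
Arguments unit_sphere {R cplx} V.

Section convexity.
Context {R : realType} {cplx : bool}.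
Local Notation K := (scalar_field R cplx).

(* In the order of the complex numbers [0 <= t <= 1] forces [t] to be real, so
   convex combinations below have real weights for both choices of scalars. *)
Definition convex_hull (V : lmodType K) (A : set V) : set V :=
  smallest (@convex_set K V) A.

Definition extreme_points (V : lmodType K) (C : set V) : set V :=
  [set x | C x /\ forall (y z : V) (t : K), C y -> C z -> 0 < t < 1 ->
     x = t *: y + (1 - t) *: z -> y = x /\ z = x].

Definition spear_set (Z : normedModType K) (F : set Z) : Prop :=
  F `<=` unit_ball Z /\
  forall z : Z,
    sup [set rnorm (f + w *: z) | f in F & w in unimodular] = 1 + rnorm z.

End convexity.

Section bounded_operators.
Context {R : realType} {cplx : bool}.
Local Notation K := (scalar_field R cplx).
Variables X Y : normedModType K.

Definition bop_pred : {pred X -> Y} :=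
  [pred f : X -> Y | `[< linear f /\ continuous f >]].

Record bop := Bop { bop_fun :> X -> Y ; _ : bop_fun \in bop_pred }.

HB.instance Definition _ := [isSub for bop_fun].
HB.instance Definition _ := [Choice of bop by <:].

Lemma bopP (f : bop) : linear f /\ continuous f.
Proof. by case: f => f /= /asboolP. Qed.

Fact bop_submod_closed : submod_closed bop_pred.
Proof.
split.
  apply/asboolP; split; last by move=> x; exact: cvg_cst.
  by move=> a x y; rewrite /GRing.zero /= scaler0 addr0.
move=> a f g /asboolP[lf cf] /asboolP[lg cg]; apply/asboolP; split.
  move=> b x y; rewrite !fctE lf lg.
  by rewrite !scalerDr !scalerA (mulrC a b) addrACA.
by move=> x; apply: cvgD; [apply: cvgZl_tmp; exact: cf|exact: cg].
Qed.

HB.instance Definition _ :=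
  GRing.isSubmodClosed.Build K (X -> Y) bop_pred bop_submod_closed.
HB.instance Definition _ := [SubChoice_isSubLmodule of bop by <:].


Definition opnorm (f : bop) : R := sup [set rnorm (f x) | x in unit_ball X].

Lemma bop_linear (f : bop) : linear f. Proof. exact: (bopP f).1. Qed.

HB.instance Definition _ (f : bop) :=
  GRing.isLinear.Build K X Y *:%R (bop_fun f) (bop_linear f).

Lemma bop_has_sup (f : bop) : has_sup [set rnorm (f x) | x in unit_ball X].
Proof.
split; first by exists (rnorm (f 0)), 0 => //=; rewrite /unit_ball /= normr0.
have /linear_bounded_continuous/bounded_funP/(_ 1)[M Mf] := (bopP f).2.
exists (re_part M) => _ [x x1 <-]; exact/le_re/Mf.
Qed.

Lemma le_opnorm (f : bop) x : rnorm (f x) <= opnorm f * rnorm x.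
Proof.
have [->|x0] := eqVneq x 0.
  have r0 (V : normedModType K) : rnorm (0 : V) = 0.
    by rewrite /rnorm normr0 -of_real0 of_realK.
  by rewrite linear0 !r0 mulr0.
pose c : K := `|x|^-1.
have nx : `|x| != 0 by rewrite normr_eq0.
have le1 : rnorm (f (c *: x)) <= opnorm f.
  apply: (sup_upper_bound (bop_has_sup f)); exists (c *: x) => //.
  by rewrite /unit_ball /= normrZ normfV normr_id mulVf.
have -> : f x = `|x| *: f (c *: x) by rewrite linearZ /= scalerA mulfV // scale1r.
by rewrite rnormZ normr_id mulrC ler_wpM2r // rnorm_ge0.
Qed.

Lemma opnorm_le (f : bop) r :
  (forall x, `|x| <= 1 -> rnorm (f x) <= r) -> opnorm f <= r.
Proof.
move=> fr; apply: ge_sup; first exact: (bop_has_sup f).1.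
by move=> _ [x x1 <-]; exact: fr.
Qed.

Lemma le_opnorm_ball (f : bop) x : `|x| <= 1 -> rnorm (f x) <= opnorm f.
Proof. by move=> x1; apply: (sup_upper_bound (bop_has_sup f)); exists x. Qed.

Lemma opnorm_ge0 (f : bop) : 0 <= opnorm f.
Proof.
by apply: le_trans (rnorm_ge0 (f 0)) _; apply: le_opnorm_ball; rewrite normr0.
Qed.

Let norm (f : bop) : K := of_real cplx (opnorm f).

Fact bop_normD f g : norm (f + g) <= norm f + norm g.
Proof.
rewrite -of_realD le_of_real; apply: opnorm_le => x x1.
by apply: le_trans (rnormD _ _) (lerD _ _); exact: le_opnorm_ball.
Qed.

Fact bop_normZ (a : K) f : norm (a *: f) = `|a| * norm f.
Proof.
have leZ b g : opnorm (b *: g) <= re_part `|b| * opnorm g.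
  apply: opnorm_le => x x1; rewrite [X in rnorm X](_ : _ = b *: g x) // rnormZ.
  by apply: ler_wpM2l; [exact: (@rnorm_ge0 _ _ K^o b)|exact: le_opnorm_ball].
rewrite -[`|a|]reK // -of_realM; congr of_real; apply/eqP; rewrite eq_le leZ /=.
have [->|a0] := eqVneq a 0.
  by rewrite normr0 -[re_part 0](_ : 0 = _) ?mul0r ?opnorm_ge0 // -of_real0 of_realK.
have -> : opnorm f = opnorm (a^-1 *: (a *: f)).
  by rewrite scalerA mulVf // scale1r.
have a1 : re_part `|a| * re_part `|a^-1| = 1.
  by rewrite -[LHS](@of_realK _ cplx) of_realM !reK // -normrM mulfV // normr1
    -of_real1 of_realK.
rewrite -[leRHS]mul1r -a1 -mulrA; apply: ler_wpM2l => //.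
exact: (@rnorm_ge0 _ _ K^o a).
Qed.

Fact bop_norm0_eq0 f : norm f = 0 -> f = 0.
Proof.
rewrite /norm -[0 in X in X -> _]of_real0 => /(can_inj of_realK) f0.
apply: val_inj; apply/funext => x /=; apply/normr0_eq0.
rewrite -of_rnorm -of_real0; congr of_real; apply/eqP.
by rewrite eq_le rnorm_ge0 (le_trans (le_opnorm f x)) // f0 mul0r.
Qed.

HB.instance Definition _ :=
  @Lmodule_isNormed.Build K bop norm bop_normD bop_normZ bop_norm0_eq0.

Lemma rnorm_bopE (f : bop) : rnorm f = opnorm f.
Proof. exact: of_realK. Qed.

Definition rank_one (f : bop) : Prop :=
  exists2 y : Y, y != 0 & range f = [set a *: y | a in [set: K]].

Definition alternative_daugavet (G : bop) : Prop :=
  forall T : bop, rank_one T ->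
    sup [set rnorm (G + w *: T) | w in unimodular] = 1 + rnorm T.

End bounded_operators.
Arguments bop_pred {R cplx} X Y.

Section duality.
Context {R : realType} {cplx : bool}.
Local Notation K := (scalar_field R cplx).

Definition dual_space (X : normedModType K) := bop X K^o.

Definition weak_star (X : normedModType K) :=
  initial_topology (fun f : dual_space X => (f : X -> K^o) : {ptws X -> K^o}).

HB.instance Definition _ (X : normedModType K) :=
  Topological.on (weak_star X).

Fact adjoint_subproof (X Y : normedModType K) (G : bop X Y) (f : dual_space Y) :
  (f : Y -> K^o) \o G \in bop_pred X K^o.
Proof.
apply/asboolP; split; first by move=> a x y /=; rewrite !linearP.
by move=> x; apply: continuous_comp; [exact: (bopP G).2|exact: (bopP f).2].
Qed.

Definition adjoint (X Y : normedModType K) (G : bop X Y) (f : dual_space Y) : dual_space X :=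
  Bop (adjoint_subproof G f).

Definition is_slice (X : normedModType K) (A S : set X) : Prop :=
  exists (f : dual_space X) (a : R), 0 < a /\
    S = [set x | A x /\ re_part (f x) > sup [set re_part (f y) | y in A] - a].

Definition is_weak_star_slice (Y : normedModType K) (A S : set (dual_space Y)) : Prop :=
  exists (y : Y) (a : R), 0 < a /\
    S = [set f | A f /\ re_part (f y) > sup [set re_part (g y) | g in A] - a].

(* The extreme points of the dual ball, as a subset of the dual space with its weak*
   topology; coerced to a type, it carries the subspace topology. *)
Definition ext_dual_ball (Y : normedModType K) : set (weak_star Y) :=
  extreme_points (unit_ball (dual_space Y)).

Arguments ext_dual_ball : clear implicits.

Definition norm_additive (X Y : normedModType K) (G : bop X Y) (f0 : dual_space X) :
    set (ext_dual_ball Y) :=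
  [set f | sup [set rnorm (adjoint G (\val f) + w *: f0) | w in unimodular]
           = 1 + rnorm f0].

End duality.
Arguments ext_dual_ball {R cplx} Y.

(* Main.v *)
(* Everything is compared with the symmetric property [norming_triples]: for all
   [f] in X*, [y] in [Y] and [e > 0] there are [x] in the ball of [X] and [g] in the ball
   of Y* such that [|f x|], [|g (G x)|] and [|g y|] are [e]-close to [|f|], [1] and
   [|y|].  Rotating [x] and [g] makes two of these scalars positive, and then the
   sum of two real parts is a functional of [x] alone (or of [g] alone), so that
   [x] may be taken in any set whose closed convex hull is the ball.  This
   gives (i), (ii), (ii-star) and, with Hahn-Banach, (iii).

   For (iv), the norming extreme functionals and Choquet's lemma are obtained
   without weak* compactness, from minimal sublinear functionals whose set of
   dominated linear functionals is a face.  Baire category is replaced by a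
   perturbation argument: every [y] is close to a sum [z] of a series
   [y + sum_n c_n G x_n] such that every functional norming [z] satisfies (iv). *)
From HB Require Import structures.
Require Import Defs.
From mathcomp Require Import all_boot all_order all_algebra.
From mathcomp Require Import complex.
From mathcomp Require Import all_classical all_reals all_analysis.
From mathcomp Require Import borel_hierarchy lra.

Set Implicit Arguments.
Unset Strict Implicit.
Unset Printing Implicit Defensive.

Import Order.TTheory GRing.Theory Num.Theory.
Import numFieldNormedType.Exports.

Local Open Scope classical_set_scope.
Local Open Scope ring_scope.

(** * Real parts and moduli of scalars, for both fields at once *)

Section scalars.
Context {R : realType} {cplx : bool}.
Local Notation K := (scalar_field R cplx).
Local Notation "t %:K" := (of_real cplx t) (at level 2, format "t %:K").
Implicit Types (z w : K) (t : R).

Lemma of_realN t : (- t)%:K = - t%:K :> K.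
Proof. by case: cplx => //=; rewrite rmorphN. Qed.

Lemma lt_of_real (s t : R) : (s%:K < t%:K :> K) = (s < t).
Proof. by case: cplx => //=; rewrite ltcR. Qed.

Lemma of_realB1 t : (1 - t)%:K = 1 - t%:K :> K.
Proof. by rewrite of_realD of_realN of_real1. Qed.

Lemma of_real_itv01 t : (0 < (t%:K : K) < 1) = (0 < t < 1).
Proof. by rewrite -of_real0 -of_real1 !lt_of_real. Qed.

Lemma re_part0 : re_part (0 : K) = 0.
Proof. by rewrite -of_real0 of_realK. Qed.

Lemma re_partD z w : re_part (z + w) = re_part z + re_part w.
Proof. by case: cplx z w => //= -[a b] [c d]. Qed.

Lemma re_partN z : re_part (- z) = - re_part z.
Proof. by case: cplx z => //= -[a b]. Qed.

Lemma re_partZ t z : re_part (t%:K * z) = t * re_part z.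
Proof. by case: cplx z => //= -[a b] /=; rewrite mul0r subr0. Qed.

Lemma norm_of_real t : `|t%:K : K| = `|t|%:K.
Proof. by case: cplx => //=; rewrite normc_def /= expr0n addr0 sqrtr_sqr. Qed.

Lemma re_part_le_norm (z : K^o) : re_part z <= rnorm z.
Proof.
rewrite /rnorm; case: cplx z => /= [[a b]|z]; last exact: ler_norm.
rewrite -[leRHS]/(complex.Re `|Complex a b|) normc_def /=.
by rewrite (le_trans (ler_norm a)) // -sqrtr_sqr ler_wsqrtr // lerDl sqr_ge0.
Qed.

Lemma rotate_norm z : exists2 w : K, `|w| = 1 & w * z = `|z|.
Proof.
have [->|z0] := eqVneq z 0; first by exists 1; rewrite ?normr1 // mulr0 normr0.
have nz : `|z| != 0 by rewrite normr_eq0.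
exists (`|z| / z); last by rewrite divfK.
by rewrite normrM normfV normr_id mulfV.
Qed.

(* The imaginary unit, replaced by [0] for real scalars. *)
Definition im_unit : K :=
  match cplx return scalar_field R cplx with true => 'i%C | false => 0 end.

(** The real part of [im_unit * z] is minus the imaginary part of [z], or zero for real scalars, so
    real parts alone control the modulus. *)
Lemma rnorm_le_re (z : K^o) :
  rnorm z <= `|re_part z| + `|re_part (im_unit * z)|.
Proof.
rewrite /rnorm /im_unit; case: cplx z => /= [[a b]|z]; last first.
  by rewrite lerDl.
rewrite -[leLHS]/(complex.Re `|Complex a b|) normc_def /=.
rewrite mul0r mul1r sub0r normrN -[leRHS]ger0_norm ?addr_ge0 // -sqrtr_sqr.
rewrite ler_wsqrtr // sqrrD !real_normK ?num_real //.
by rewrite addrAC lerDl mulrn_wge0 // mulr_ge0.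
Qed.

End scalars.

(** * Sublinear functionals, faces and the Hahn-Banach theorem *)

Section sublinear.
Context {R : realType} {cplx : bool}.
Local Notation K := (scalar_field R cplx).
Local Notation "t %:K" := (of_real cplx t) (at level 2, format "t %:K").
Variable V : lmodType K.
Implicit Types (p q h : V -> R) (v x y : V) (t r : R) (D : set V).

Definition sublinear p :=
  (forall x y, p (x + y) <= p x + p y) /\
  (forall t x, 0 <= t -> p (t%:K *: x) <= t * p x).

Definition real_linear h := forall t x y, h (t%:K *: x + y) = t * h x + h y.

Lemma real_linearD h x y : real_linear h -> h (x + y) = h x + h y.
Proof.
by move=> /(_ 1 x y); rewrite of_real1 scale1r mul1r.
Qed.

Lemma real_linear0 h : real_linear h -> h 0 = 0.
Proof.
by move=> hl; have := real_linearD 0 0 hl; rewrite addr0; lra.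
Qed.

Lemma real_linearZ h t x : real_linear h -> h (t%:K *: x) = t * h x.
Proof.
by move=> hl; rewrite -[_ *: _]addr0 hl real_linear0 // addr0.
Qed.

Lemma real_linearN h x : real_linear h -> h (- x) = - h x.
Proof.
by move=> hl; have := real_linearD x (- x) hl; rewrite subrr real_linear0 //; lra.
Qed.

Lemma real_linear_le_eq h1 h2 : real_linear h1 -> real_linear h2 ->
  (forall x, h1 x <= h2 x) -> forall x, h1 x = h2 x.
Proof.
move=> l1 l2 le x; apply/eqP; rewrite eq_le le /=.
by have := le (- x); rewrite !real_linearN // lerN2.
Qed.

Lemma sublinear0 p : sublinear p -> p 0 = 0.
Proof.
move=> [pD pZ]; have := pZ 0 0 (lexx _); have := pD 0 0.
by rewrite scaler0 addr0 mul0r; lra.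
Qed.

Lemma sublinear_odd_linear q : sublinear q -> (forall x, q (- x) <= - q x) ->
  real_linear q.
Proof.
move=> sq qN; have q0 := sublinear0 sq; have [qD qZ] := sq.
have qNE x : q (- x) = - q x.
  by have := qN x; have := qD x (- x); rewrite subrr q0; lra.
have qDE x y : q (x + y) = q x + q y.
  by have := qD x y; have := qD (x + y) (- y); rewrite addrK qNE; lra.
have qZE t x : 0 <= t -> q (t%:K *: x) = t * q x.
  move=> t0; have := qZ t x t0; have := qZ t (- x) t0.
  by rewrite scalerN !qNE; lra.
move=> t x y; rewrite qDE; congr (_ + _); have [/qZE//|t0] := leP 0 t.
have Nt0 : 0 <= - t by rewrite oppr_ge0 ltW.
by rewrite -[t]opprK of_realN scaleNr qNE qZE ?mulNr.
Qed.

(** The index [k] may vary with the vectors; this covers the infimum in [lower], the infimum of a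
    chain in [face_linear] and that over all splittings in [extreme_decomposition]. *)
Lemma inf_sublinear (I : Type) (A : set I) (F : I -> V -> R) :
  A !=set0 ->
  (forall x, exists m, forall i, A i -> m <= F i x) ->
  (forall i j x y, A i -> A j -> exists2 k, A k & F k (x + y) <= F i x + F j y) ->
  (forall i t x, A i -> 0 <= t -> exists2 k, A k & F k (t%:K *: x) <= t * F i x) ->
  sublinear (fun x => inf [set F i x | i in A]).
Proof.
move=> A0 lbA FD FZ; set q := fun x => _.
have qF x i : A i -> q x <= F i x.
  move=> Ai; apply: ge_inf; last by exists i.
  by have [m mF] := lbA x; exists m => _ [j Aj <-]; exact: mF.
have geq x m : (forall i, A i -> m <= F i x) -> m <= q x.
  move=> mF; apply: lb_le_inf.
    by have [i Ai] := A0; exists (F i x), i.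
  by move=> _ [i Ai <-]; exact: mF.
split=> [x y|t x t0].
  rewrite -lerBlDr; apply: (geq x) => i Ai; rewrite lerBlDl -lerBlDr.
  apply: (geq y) => j Aj; have [k Ak kij] := FD i j x y Ai Aj.
  by rewrite lerBlDr (le_trans (qF _ _ Ak)) // [leRHS]addrC.
have [t_eq0|tn0] := eqVneq t 0.
  have [i Ai] := A0; have [k Ak] := FZ i t x Ai t0.
  by rewrite t_eq0 !mul0r; apply: le_trans; exact: qF.
have tp : 0 < t by rewrite lt_neqAle eq_sym tn0.
rewrite -ler_pdivrMl //; apply: geq => i Ai; rewrite ler_pdivrMl //.
by have [k Ak] := FZ i t x Ai t0; apply: le_trans; exact: qF.
Qed.

Definition real_convex D := forall x y t, D x -> D y -> 0 <= t <= 1 ->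
  D (t%:K *: x + (1 - t)%:K *: y).

(* The largest sublinear functional below [p] that is at most [- r] on [- D]. *)
Definition lower p D r v : R :=
  inf [set p (v + td.1%:K *: td.2) - td.1 * r | td in [set td | 0 <= td.1 /\ D td.2]].

Section lower.
Variables (p : V -> R) (D : set V) (r : R).
Hypotheses (sp : sublinear p) (D0 : D !=set0) (cD : real_convex D).
Hypothesis rD : forall d, D d -> r <= p d.

(** This bound keeps the infimum in [lower] finite: subadditivity bounds [p (t d)] by
    [p (v + t d) + p (- v)], and homogeneity at [t^-1] bounds it below by [t p d]. *)
Lemma lower_lb v t d : 0 <= t -> D d -> - p (- v) <= p (v + t%:K *: d) - t * r.
Proof.
move=> t0 Dd; have [pD pZ] := sp.
have := pD (v + t%:K *: d) (- v); rewrite addrAC subrr add0r.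
have [->|tn0] := eqVneq t 0.
  by rewrite of_real0 scale0r addr0 (sublinear0 sp) mul0r; lra.
have tp : 0 < t by rewrite lt_neqAle eq_sym tn0.
have tV0 : 0 <= t^-1 by rewrite invr_ge0.
have := pZ _ (t%:K *: d) tV0.
rewrite scalerA -of_realM mulVf // of_real1 scale1r.
rewrite -ler_pdivrMl ?invr_gt0 // invrK.
have : t * r <= t * p d by rewrite ler_wpM2l // rD.
by lra.
Qed.

Lemma lower_sublinear : sublinear (lower p D r).
Proof.
have [pD pZ] := sp.
apply: inf_sublinear.
- by have [d Dd] := D0; exists (0, d).
- by move=> x; exists (- p (- x)) => -[t d] [/= t0 Dd]; exact: lower_lb.
- move=> [t1 d1] [t2 d2] x y [/= t10 D1] [/= t20 D2].
  have [s0|sn0] := eqVneq (t1 + t2) 0.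
    have [-> ->] : t1 = 0 /\ t2 = 0 by split; lra.
    exists (0, d1) => //=; rewrite of_real0 !scale0r !mul0r !subr0 !addr0.
    exact: pD.
  have sp0 : 0 < t1 + t2 by rewrite lt_neqAle eq_sym sn0 addr_ge0.
  (* With this weight, [t1 d1 + t2 d2] is [t1 + t2] times a point of [D]. *)
  pose c := t1 / (t1 + t2).
  have c01 : 0 <= c <= 1.
    by rewrite /c divr_ge0 ?(ltW sp0) //= ler_pdivrMr // mul1r lerDl.
  exists (t1 + t2, c%:K *: d1 + (1 - c)%:K *: d2).
    by split; [exact: ltW|exact: cD].
  rewrite /= scalerDr !scalerA -!of_realM.
  have cE : (t1 + t2) * c = t1 by rewrite mulrC divfK.
  rewrite mulrBr mulr1 cE (addrAC t1) subrr add0r.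
  have := pD (x + t1%:K *: d1) (y + t2%:K *: d2).
  by rewrite addrACA; lra.
- move=> [t d] s x [/= t0 Dd] s0; exists (s * t, d); first by split => //=; exact: mulr_ge0.
  rewrite /= of_realM -scalerA -scalerDr mulrBr -mulrA lerD2r.
  exact: pZ.
Qed.

Lemma lower_leP v t d : 0 <= t -> D d -> lower p D r v <= p (v + t%:K *: d) - t * r.
Proof.
move=> t0 Dd; apply: ge_inf; last by exists (t, d).
by exists (- p (- v)) => _ [[s e] [/= s0 De] <-]; exact: lower_lb.
Qed.

Lemma lower_le v : lower p D r v <= p v.
Proof.
have [d Dd] := D0; have := lower_leP v (lexx 0) Dd.
by rewrite of_real0 scale0r mul0r addr0 subr0.
Qed.

Lemma lowerN d : D d -> lower p D r (- d) <= - r.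
Proof.
move=> Dd; have := lower_leP (- d) ler01 Dd.
by rewrite of_real1 scale1r addNr (sublinear0 sp) mul1r sub0r.
Qed.

End lower.

(* The linear functionals below [q] form a face of the convex set of linear
   functionals below [p]. *)
Definition face p q := [/\ sublinear q, (forall v, q v <= p v) &
  forall h1 h2 t, real_linear h1 -> real_linear h2 ->
    (forall v, h1 v <= p v) -> (forall v, h2 v <= p v) -> 0 < t < 1 ->
    (forall v, t * h1 v + (1 - t) * h2 v <= q v) ->
    (forall v, h1 v <= q v) /\ (forall v, h2 v <= q v)].

Lemma real_convex1 v : real_convex [set v].
Proof.
by move=> x y t /= -> -> _; rewrite -scalerDl -of_realD subrKC of_real1 scale1r.
Qed.

Lemma lower_le_real_linear q h d : sublinear q -> real_linear h ->
  (forall v, h v <= q v) -> q d <= h d ->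
  forall v, h v <= lower q [set d] (q d) v.
Proof.
move=> sq hl hq dd v; apply: lb_le_inf.
  by exists (q (v + 0%:K *: d) - 0 * q d), (0, d).
move=> _ [[t e] [/= t0 ->] <-].
have := hq (v + t%:K *: d); rewrite real_linearD // real_linearZ //.
have : t * q d <= t * h d by rewrite ler_wpM2l.
by lra.
Qed.

(** The linear functionals below the new bound are those below [q] with value exactly [q d] at [d];
    in a face, those that reach the upper bound of an evaluation form a subface. *)
Lemma face_lower p q d : face p q -> face p (lower q [set d] (q d)).
Proof.
move=> [sq qp fq]; have d1 : [set d] !=set0 by exists d.
have cd := @real_convex1 d.
have rd e : [set d] e -> q d <= q e by move=> ->.
split; first exact: lower_sublinear.
  by move=> v; apply: le_trans (qp v); exact: lower_le.
move=> h1 h2 t l1 l2 h1p h2p t01 hq.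
have [] := fq h1 h2 t l1 l2 h1p h2p t01.
  by move=> v; apply: le_trans (hq v) _; exact: lower_le.
move=> h1q h2q.
(* At [- d] the hypothesis says that a weighted mean of [h1 d] and [h2 d] is at least [q d]; neither
   exceeds [q d], so both equal it. *)
have := hq (- d); have := @lowerN q [set d] (q d) sq rd d erefl.
rewrite (real_linearN d l1) (real_linearN d l2); have := h1q d; have := h2q d.
have [t0 t1] := andP t01 => a b c e.
have key : t * (q d - h1 d) + (1 - t) * (q d - h2 d) <= 0 by lra.
have k1 : 0 <= t * (q d - h1 d) by rewrite mulr_ge0 ?subr_ge0 // ltW.
have k2 : 0 <= (1 - t) * (q d - h2 d) by rewrite mulr_ge0 ?subr_ge0 // ltW.
have z1 : t * (q d - h1 d) <= 0 by lra.
have z2 : (1 - t) * (q d - h2 d) <= 0 by lra.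
rewrite pmulr_rle0 // subr_le0 in z1.
rewrite pmulr_rle0 ?subr_gt0 // subr_le0 in z2.
by split=> v; apply: lower_le_real_linear.
Qed.

(* Zorn's lemma gives a minimal face [q] below [q0]; it coincides with its
   subfaces [lower q [set d] (q d)], which forces [q] to be linear. *)
Lemma face_linear p q0 : face p q0 ->
  exists h, [/\ real_linear h, face p h & forall v, h v <= q0 v].
Proof.
move=> fq0.
pose T := {q | face p q /\ forall v, q v <= q0 v}.
pose t0 : T := exist _ q0 (conj fq0 (fun v => lexx _)).
pose rT (s t : T) := `[< forall v, sval t v <= sval s v >].
have [||||m mmin] := @Zorn T rT.
- by move=> t; apply/asboolP => v.
- move=> a b c /asboolP ab /asboolP bc; apply/asboolP => v.
  exact: le_trans (bc v) (ab v).
- move=> [a Pa] [b Pb] /asboolP /= ab /asboolP /= ba.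
  have eab : a = b by apply/funext => v; apply/eqP; rewrite eq_le ab ba.
  by case: b / eab Pb {ab ba} => Pb; rewrite (Prop_irrelevance Pa Pb).
(* Adjoining [t0], which lies above every element of [T], gives the empty chain a bound as well. *)
- move=> A totA; pose A' := A `|` [set t0].
  have cmp a b : A' a -> A' b -> exists2 c, A' c &
      (forall v, sval c v <= sval a v) /\ (forall v, sval c v <= sval b v).
    have le0 (c : T) v : sval c v <= sval t0 v by have [_] := svalP c; exact.
    move=> [Aa|->] [Ab|->].
    + have [/asboolP ab|/asboolP ba] := totA a b Aa Ab.
        by exists b; [left|].
      by exists a; [left|].
    + by exists a; [left|].
    + by exists b; [left|].
    + by exists t0; [right|].
  have sA (c : T) : sublinear (sval c) by have [[]] := svalP c.
  have cp (c : T) v : sval c v <= p v by have [[]] := svalP c.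
  have lb v : exists m, forall i, A' i -> m <= sval i v.
    exists (- p (- v)) => i _; have [iD _] := sA i.
    have := iD v (- v); rewrite subrr (sublinear0 (sA i)).
    by have := cp i (- v); lra.
  pose q v := inf [set sval i v | i in A'].
  have qA i v : A' i -> q v <= sval i v.
    move=> Ai; apply: ge_inf; last by exists i.
    by have [m mF] := lb v; exists m => _ [j Aj <-]; exact: mF.
  have geq x m : (forall i, A' i -> m <= sval i x) -> m <= q x.
    move=> mF; apply: lb_le_inf; first by exists (sval t0 x), t0 => //; right.
    by move=> _ [i Ai <-]; exact: mF.
  have fq : face p q.
    split.
    + apply: inf_sublinear => //; first by exists t0; right.
        move=> i j x y Ai Aj; have [k Ak [ki kj]] := cmp i j Ai Aj.
        exists k => //; have [kD _] := sA k.
        by apply: le_trans (kD x y) _; apply: lerD.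
      by move=> i t x Ai t_ge0; exists i => //; have [_] := sA i; exact.
    + by move=> v; apply: le_trans (qA t0 v _) (cp t0 v); right.
    + move=> h1 h2 t l1 l2 h1p h2p t01 hq.
      have hi i : A' i -> (forall v, h1 v <= sval i v) /\ (forall v, h2 v <= sval i v).
        move=> Ai; have [[_ _ fi] _] := svalP i; apply: (fi h1 h2 t) => // v.
        exact: le_trans (hq v) (qA _ _ Ai).
      by split=> v; apply: geq => i /hi[].
  exists (exist _ q (conj fq (fun v => qA t0 v (or_intror erefl)))).
  by move=> s As; apply/asboolP => v; apply: qA; left.
have [fm m0] := svalP m; have [sm _ _] := fm.
have lm d : forall v, lower (sval m) [set d] (sval m d) v <= sval m v.
  apply: lower_le => //; first by exists d.
  by move=> e ->.
exists (sval m); split => //.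
apply: sublinear_odd_linear => // d.
pose m' : T := exist _ _ (conj (face_lower d fm)
  (fun v => le_trans (lm d v) (m0 v))).
have mm' : m' = m by apply: mmin; apply/asboolP => v; exact: lm.
have <- : sval m' (- d) = sval m (- d) by rewrite mm'.
by apply: lowerN => // e ->.
Qed.

(** The functional [lower p D r] is trivially a face of itself, so [face_linear] yields a linear [h]
    below it; its bound at [- d] is the lower bound of [h] at [d]. *)
Lemma hahn_banach p D r : sublinear p -> D !=set0 -> real_convex D ->
  (forall d, D d -> r <= p d) ->
  exists h, [/\ real_linear h, (forall v, h v <= p v) &
    forall d, D d -> r <= h d].
Proof.
move=> sp D0 cD rD; set q := lower p D r.
have sq : sublinear q by exact: lower_sublinear.
have [h [hl _ hq]] := face_linear (And3 sq (fun v => lexx (q v))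
  (fun h1 h2 t _ _ h1q h2q _ _ => conj h1q h2q)).
exists h; split => // [v|d Dd].
  by apply: le_trans (hq v) _; exact: lower_le.
have := le_trans (hq (- d)) (lowerN sp rD Dd).
by rewrite real_linearN // lerN2.
Qed.

End sublinear.

(** * Norms and real parts of functionals in the dual space *)

Section dual.
Context {R : realType} {cplx : bool}.
Local Notation K := (scalar_field R cplx).
Local Notation "t %:K" := (of_real cplx t) (at level 2, format "t %:K").
Local Notation re := (@re_part R cplx).
Implicit Types (V X Y : normedModType K).

Lemma norm_le1E V (x : V) : (`|x| <= 1) = (rnorm x <= 1).
Proof. by rewrite -of_rnorm -of_real1 le_of_real. Qed.

Lemma norm_eq1E V (x : V) : (`|x| = 1) <-> (rnorm x = 1).
Proof.
rewrite -of_rnorm -of_real1; split => [/(can_inj of_realK)//|->//].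
Qed.

Lemma rnorm_of_realZ V (t : R) (x : V) : rnorm (t%:K *: x) = `|t| * rnorm x.
Proof. by rewrite rnormZ norm_of_real of_realK. Qed.

Lemma rnorm_unitZ V (w : K) (x : V) : `|w| = 1 -> rnorm (w *: x) = rnorm x.
Proof. by move=> w1; rewrite /rnorm normrZ w1 mul1r. Qed.

Lemma rnorm0 V : rnorm (0 : V) = 0.
Proof. by rewrite /rnorm normr0 re_part0. Qed.

Lemma rnormN V (x : V) : rnorm (- x) = rnorm x.
Proof. by rewrite /rnorm normrN. Qed.

Lemma rnorm_eq0 V (x : V) : (rnorm x == 0) = (x == 0).
Proof.
rewrite -[RHS]normr_eq0 -of_rnorm; apply/eqP/eqP => [->|]; first exact: of_real0.
by rewrite -(of_real0 (cplx := cplx)) => /(can_inj of_realK).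
Qed.

Lemma ler_rnormB V (x y : V) : rnorm x - rnorm y <= rnorm (x + y).
Proof. by have := rnormD (x + y) (- y); rewrite addrK rnormN; lra. Qed.

Lemma rnormM_unit (w z : K^o) : `|w| = 1 -> rnorm (w * z : K^o) = rnorm z.
Proof. by move=> w1; rewrite /rnorm normrM w1 mul1r. Qed.

Lemma rotate_re (z : K^o) : exists2 w : K, `|w| = 1 & re (w * z) = rnorm z.
Proof. by have [w w1 wz] := rotate_norm z; exists w => //; rewrite wz. Qed.

Lemma rnorm_sublinear V : sublinear (@rnorm R cplx V).
Proof.
split; first exact: rnormD.
by move=> t x t0; rewrite rnorm_of_realZ ger0_norm.
Qed.

Lemma re_dual_linear X (f : dual_space X) : real_linear (fun x => re (f x)).
Proof. by move=> t x y; rewrite linearP re_partD re_partZ. Qed.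

Lemma le_dual X (f : dual_space X) x : rnorm (f x) <= rnorm f * rnorm x.
Proof. by rewrite rnorm_bopE; exact: le_opnorm. Qed.

Lemma dual_ball_le X (f : dual_space X) x : `|f| <= 1 -> rnorm (f x) <= rnorm x.
Proof.
rewrite norm_le1E => f1; apply: le_trans (le_dual f x) _.
by rewrite ler_piMl // rnorm_ge0.
Qed.

Lemma re_dual_ball_le X (f : dual_space X) x : `|f| <= 1 -> re (f x) <= rnorm x.
Proof. by move=> f1; apply: le_trans (re_part_le_norm _) (dual_ball_le _ f1). Qed.

(** Rotating [x] turns the difference of the values into its modulus, a real number with vanishing
    real part. *)
Lemma dual_eq_re X (f g : dual_space X) : (forall x, re (f x) = re (g x)) -> f = g.
Proof.
move=> fg; apply: val_inj; apply/funext => x /=.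
have [w w1 wz] := rotate_norm (f x - g x).
have wfg : w * (f x - g x) = f (w *: x) - g (w *: x).
  by rewrite !linearZ /= mulrBr scalerN.
have fg0 : w * (f x - g x) = 0.
  rewrite wz -[LHS]reK // -wz wfg.
  by rewrite re_partD re_partN !fg subrr of_real0.
have w0 : w != 0 by rewrite -normr_eq0 w1 oner_eq0.
by move/eqP: fg0; rewrite mulf_eq0 (negPf w0) subr_eq0 => /eqP.
Qed.

(** In the complex case the functional is [h x - i h (i x)]. The norm bound passes from [h] to it by
    rotating [x] until the value is positive. *)
Lemma complexify X (h : X -> R) : real_linear h -> (forall x, h x <= rnorm x) ->
  exists2 f : dual_space X, `|f| <= 1 & forall x, re (f x) = h x.
Proof.
move=> hl hn.
have [F [Fl Fre]] : exists F : X -> K^o, linear F /\ forall x, re (F x) = h x.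
  move: X h hl hn; rewrite /re_part.
  case: cplx => X h hl hn /=.
    exists (fun x => Complex (h x) (- h ('i%C *: x))); split => // a x y.
    have key z : a *: z = (complex.Re a)%:C%C *: z + (complex.Im a)%:C%C *: ('i%C *: z).
      rewrite scalerA -scalerDl; congr (_ *: _).
      by case: a => a b; simpc.
    have hZ z : h (a *: z) = complex.Re a * h z + complex.Im a * h ('i%C *: z).
      by rewrite key (hl (complex.Re a)) (real_linearZ _ _ hl).
    have ha z : h (a *: z + y) = h (a *: z) + h y by rewrite (real_linearD _ _ hl).
    have hi : h ('i%C *: (a *: x + y)) =
        complex.Re a * h ('i%C *: x) - complex.Im a * h x + h ('i%C *: y).
      rewrite scalerDr (real_linearD _ _ hl); congr (_ + _).
      rewrite scalerA mulrC -scalerA hZ scalerA -expr2 sqr_i scaleN1r.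
      by rewrite (real_linearN _ hl) mulrN.
    rewrite ha hZ hi; case: a {key hZ ha hi} => a b /=.
    by congr Complex; lra.
  by exists h; split.
pose Fb : {linear X -> K^o} := HB.pack F (GRing.isLinear.Build _ _ _ _ F Fl).
have Fn x : rnorm (F x) <= rnorm x.
  have [w w1 <-] := rotate_re (F x).
  rewrite -[w * F x]/(w *: Fb x) -linearZ /=.
  by rewrite Fre (le_trans (hn _)) // rnorm_unitZ.
have Fp : F \in bop_pred X K^o.
  apply/asboolP; split => //.
  have : bounded_near Fb (nbhs (0 : X)).
    apply/bounded_funP => r; exists r => x xr.
    apply: le_trans xr.
    by rewrite -!of_rnorm le_of_real; exact: Fn.
  by move/linear_bounded_continuous.
exists (Bop Fp) => //; rewrite norm_le1E rnorm_bopE.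
apply: opnorm_le => x x1 /=; apply: le_trans (Fn x) _.
by rewrite -norm_le1E.
Qed.

End dual.

(** * Separation, and extreme points of the dual ball *)

Section extreme_functionals.
Context {R : realType} {cplx : bool}.
Local Notation K := (scalar_field R cplx).
Local Notation "t %:K" := (of_real cplx t) (at level 2, format "t %:K").
Local Notation re := (@re_part R cplx).
Implicit Types (X Y : normedModType K).

Lemma separation X (D : set X) (r : R) : D !=set0 -> real_convex D ->
  (forall d, D d -> r <= rnorm d) ->
  exists2 f : dual_space X, `|f| <= 1 & forall d, D d -> r <= re (f d).
Proof.
move=> D0 cD rD.
have [h [hl hn hD]] := hahn_banach (rnorm_sublinear X) D0 cD rD.
have [f f1 fh] := complexify hl hn.
by exists f => // d Dd; rewrite fh hD.
Qed.

(** The functionals of the dual ball that norm [y] form a face. A face bounded by a linear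
    functional contains that functional alone, so it gives an extreme point. *)
Lemma extreme_norming Y (y : Y) : exists2 g : dual_space Y,
  extreme_points (unit_ball (dual_space Y)) g & re (g y) = rnorm y.
Proof.
have sn := rnorm_sublinear Y.
have fn : face (@rnorm R cplx Y) (@rnorm R cplx Y).
  by split.
have [h [hl [_ hn hface] hlow]] := face_linear (face_lower y fn).
have [g g1 gh] := complexify hl hn.
exists g; last first.
  apply/eqP; rewrite eq_le re_dual_ball_le //= gh.
  have := le_trans (hlow (- y)) (lowerN sn (D := [set y]) (d := y)
    (fun e (E : e = y) => eq_ind_r (fun e => rnorm y <= rnorm e) (lexx _) E) erefl).
  by rewrite (real_linearN y hl) lerN2.
split=> // g1' g2' t /= g1b g2b t01 gE.
(* The order of the scalar field makes the weight [t] real. *)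
have [s tE] : exists s, t = s%:K.
  by exists (re t); rewrite reK // ltW //; case/andP: t01.
rewrite {t}tE of_real_itv01 in t01 gE.
have [] := hface (fun x => re (g1' x)) (fun x => re (g2' x)) s
  (re_dual_linear g1') (re_dual_linear g2')
  (fun v => re_dual_ball_le v g1b) (fun v => re_dual_ball_le v g2b) t01.
  move=> v; rewrite -gh gE.
  rewrite [X in _ <= re X](_ : _ = s%:K * g1' v + (1 - s%:K) * g2' v) //.
  by rewrite re_partD -of_realB1 !re_partZ.
move=> h1 h2; split; apply: dual_eq_re => x; rewrite gh.
  exact: (real_linear_le_eq (re_dual_linear g1') hl h1).
exact: (real_linear_le_eq (re_dual_linear g2') hl h2).
Qed.

Lemma norming X (x : X) :
  exists2 f : dual_space X, `|f| <= 1 & re (f x) = rnorm x.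
Proof. by have [f [f1 _] fx] := extreme_norming x; exists f. Qed.

(* A functional [h] lies below [rho v = inf_z (|v - z| + |z| + 2 Re g (z))] iff
   [h] and [2 g - h] both lie in the dual ball, so extremality of [g] leaves
   only [h = g]; hence [rho <= Re g] by Hahn-Banach. *)
Lemma extreme_decomposition Y (g : dual_space Y) (y : Y) (e : R) :
  extreme_points (unit_ball (dual_space Y)) g -> 0 < e ->
  exists b, (rnorm b - re (g b)) + (rnorm (y + b) - re (g (y + b))) < e.
Proof.
move=> [g1 gext] e0.
pose F (z v : Y) := rnorm (v - z) + rnorm z + 2 * re (g z).
pose rho v := inf [set F z v | z in setT].
have gF v z : re (g v) <= F z v.
  have := re_dual_ball_le (v - z) g1; have := re_dual_ball_le (- z) g1.
  by rewrite (linearB g) (linearN g) re_partD re_partN rnormN /F; lra.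
have rhoF v z : rho v <= F z v.
  by apply: ge_inf; [exists (re (g v)) => _ [u _ <-]|exists z].
have sr : sublinear rho.
  apply: inf_sublinear; first by exists 0.
  - by move=> v; exists (re (g v)).
  - move=> z1 z2 v1 v2 _ _; exists (z1 + z2) => //.
    have := rnormD z1 z2; have := rnormD (v1 - z1) (v2 - z2).
    by rewrite /F addrACA -opprD (linearD g) re_partD; lra.
  - move=> z t v _ t0; exists (t%:K *: z) => //.
    rewrite /F -scalerBr !rnorm_of_realZ ger0_norm // linearZ /= re_partZ.
    by lra.
have [h [hl hr hy]] := hahn_banach sr (ex_intro _ y erefl) (@real_convex1 R cplx Y y)
  (fun d (E : d = y) => eq_ind_r (fun d => rho y <= rho d) (lexx _) E).
have rho_gy : rho y <= re (g y).
  have hn v : h v <= rnorm v.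
    apply: le_trans (hr v) _; apply: le_trans (rhoF v 0) _.
    by rewrite /F subr0 rnorm0 (linear0 g) re_part0; lra.
  (* The choice [z = 0] in [rho] bounds [h] by the norm and [z = v] at [v] bounds this reflection;
     [g] is the midpoint of the two functionals. *)
  pose h' v := 2 * re (g v) - h v.
  have hl' : real_linear h'.
    by move=> t u v; rewrite /h' (re_dual_linear g) hl; lra.
  have hn' v : h' v <= rnorm v.
    have := le_trans (hr (- v)) (rhoF (- v) (- v)).
    rewrite (real_linearN v hl) /F subrr rnorm0 rnormN (linearN g) re_partN /h'.
    by lra.
  have [k k1 kh] := complexify hl hn.
  have [k' k'1 kh'] := complexify hl' hn'.
  have half01 : 0 < ((2^-1 : R)%:K : K) < 1 by rewrite of_real_itv01; lra.
  have [|<- _] := gext k k' _ k1 k'1 half01.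
    apply: dual_eq_re => x.
    rewrite [X in _ = re X](_ : _ = (2^-1)%:K * k x + (1 - (2^-1)%:K) * k' x) //.
    by rewrite -of_realB1 re_partD !re_partZ kh kh' /h'; lra.
  by rewrite kh; exact: hy.
have [||_ [z _ <-] zlt] := @inf_lt R [set F z y | z in setT] (re (g y) + e).
  by exists (F 0 y), 0.
  by apply: le_lt_trans rho_gy _; rewrite ltrDl.
(* For [b = - z] the sum of the two defects is [F z y - re (g y)]. *)
exists (- z); move: zlt; rewrite rnormN (linearN g) (linearB g) !re_partD !re_partN.
by rewrite /F; lra.
Qed.

End extreme_functionals.

(** * Suprema of sets of reals *)

Section suprema.
Variable R : realType.
Implicit Types (S : set R) (M e : R).

Lemma sup_eq S M : (forall a, S a -> a <= M) ->
  (forall e, 0 < e -> exists2 a, S a & M - e < a) -> sup S = M.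
Proof.
move=> SM SMe; apply/eqP; rewrite eq_le.
have S0 : S !=set0 by have [a Sa _] := SMe _ ltr01; exists a.
rewrite ge_sup //=; apply/ler_addgt0Pr => e e0.
have [a Sa /ltW Ma] := SMe e e0.
by rewrite -lerBlDr (le_trans Ma) // ub_le_sup //; exists M.
Qed.

(** Positivity of [M] excludes the empty set, whose [sup] is zero by convention. *)
Lemma sup_eq_gt S M e : sup S = M -> 0 < M -> 0 < e ->
  exists2 a, S a & M - e < a.
Proof.
move=> SM M0 e0; apply: sup_gt; last by rewrite SM ltrBlDr ltrDl.
apply/set0P; apply/negP => /eqP S0; move: M0.
by rewrite -SM S0 sup0 ltxx.
Qed.

End suprema.

(** * Closed half-spaces, convex hulls and the weak-star topology *)

Section topology.
Context {R : realType} {cplx : bool}.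
Local Notation K := (scalar_field R cplx).
Local Notation "t %:K" := (of_real cplx t) (at level 2, format "t %:K").
Local Notation re := (@re_part R cplx).
Implicit Types (X Y : normedModType K).

Lemma re_le_closure (T : topologicalType) (S : set T) (f : T -> K^o) (c : R) :
  continuous f -> (forall s, S s -> re (f s) <= c) ->
  forall x, closure S x -> re (f x) <= c.
Proof.
move=> cf Sc x Sx; rewrite leNgt; apply/negP => cx.
have e0 : 0 < (re (f x) - c)%:K :> K.
  by rewrite -(of_real0 (cplx := cplx)) lt_of_real subr_gt0.
have /cvgrPdist_lt/(_ _ e0) := cf x.
move/Sx => [s [/Sc sc]]; rewrite -of_rnorm lt_of_real => fxs.
have := re_part_le_norm (f x - f s : K^o); rewrite re_partD re_partN.
by lra.
Qed.

Lemma convex_halfspace (V : lmodType K) (f : V -> R) (c : R) :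
  real_linear f -> convex_set [set x : V | f x <= c].
Proof.
move=> fl x y t /[!inE] /= xc yc.
have [s tE] : exists s, t%:num = s%:K.
  by exists (re t%:num); rewrite reK // ge0.
have s0 : 0 <= s.
  by rewrite -(le_of_real (cplx := cplx)) of_real0 -tE ge0.
have s1 : s <= 1.
  by rewrite -(le_of_real (cplx := cplx)) of_real1 -tE le1.
rewrite /conv /= tE /unstable.onem -of_realB1 (real_linearD _ _ fl) !(real_linearZ _ _ fl).
have : s * f x <= s * c by rewrite ler_wpM2l.
have : (1 - s) * f y <= (1 - s) * c by rewrite ler_wpM2l // subr_ge0.
by lra.
Qed.

Lemma convex_hull_halfspace (V : lmodType K) (S : set V) (f : V -> R) (c : R) :
  real_linear f -> (forall s, S s -> f s <= c) ->
  forall x, convex_hull S x -> f x <= c.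
Proof.
move=> fl Sc; apply: smallest_sub => //; exact: convex_halfspace.
Qed.

Lemma convex_hull_real_convex (V : lmodType K) (S : set V) :
  real_convex (convex_hull S).
Proof.
move=> x y t hx hy /andP[t0 t1] C [/= cC SC].
have := hx C (conj cC SC); have := hy C (conj cC SC) => Cy Cx.
have t01 : (0%:K <= (t%:K : K)) && ((t%:K : K) <= 1%:K).
  by rewrite !le_of_real t0.
rewrite of_real0 of_real1 in t01.
have := cC x y (Itv01 (andP t01).1 (andP t01).2) (mem_set Cx) (mem_set Cy).
by rewrite inE /conv /= /unstable.onem -of_realB1.
Qed.

Lemma dual_continuous X (f : dual_space X) : continuous (f : X -> K^o).
Proof. exact: (bopP f).2. Qed.

Lemma weak_star_eval_continuous Y (y : Y) :
  continuous ((fun g : weak_star Y => (g : dual_space Y) y) : weak_star Y -> K^o).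
Proof.
move=> g; apply: (@continuous_comp (weak_star Y) {ptws Y -> K^o} K^o
  (fun g : dual_space Y => (g : Y -> K^o)) (@proj Y (fun _ => K^o) y)).
  exact: initial_continuous.
exact: proj_continuous.
Qed.

(** Weak-star open sets are preimages of open sets for pointwise convergence, so convergence can be
    tested on one vector at a time. *)
Lemma cvg_weak_star Y (F : set_system (weak_star Y)) (g : weak_star Y) :
  Filter F ->
  (forall y e, 0 < e ->
    F [set k | rnorm ((k : dual_space Y) y - (g : dual_space Y) y : K^o) < e]) ->
  cvg_to F (nbhs g).
Proof.
move=> FF Fy W; rewrite nbhsE => -[U [[B oB BU] Ug] UW].
have Bg : B (g : dual_space Y) by rewrite -BU in Ug.
have : {ptws, (fun k : weak_star Y => ((k : dual_space Y) : Y -> K^o)) @ F -->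
    ((g : dual_space Y) : Y -> K^o)}.
  apply/pointwise_cvgP => y; apply/cvgrPdist_lt => e e0.
  have eE : e = (re e)%:K by rewrite reK // ltW.
  have := Fy y (re e); rewrite -(lt_of_real (cplx := cplx)) of_real0 -eE => /(_ e0).
  apply: (@filterS _ F FF) => k /=; rewrite -(lt_of_real (cplx := cplx)) of_rnorm -eE.
  by rewrite distrC.
move/(_ B); rewrite nbhsE => FB.
have : F ((fun k : weak_star Y => ((k : dual_space Y) : Y -> K^o)) @^-1` B).
  by apply: FB; exists B.
by rewrite [X in F X]BU; apply: filterS.
Qed.
End topology.

(** * Slices as weak-star neighbourhoods of extreme points *)

Section slices.
Context {R : realType} {cplx : bool}.
Local Notation K := (scalar_field R cplx).
Local Notation "t %:K" := (of_real cplx t) (at level 2, format "t %:K").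
Local Notation re := (@re_part R cplx).
Implicit Types (X Y : normedModType K).

(* Choquet's lemma: slices form a neighbourhood base at an extreme point.  The
   points [b] that almost attain their norm at [g] are stable under sums, up to
   the error, so that the sets [W] below form a filter. *)
Lemma extreme_slice Y (g : dual_space Y) (W : set (weak_star Y)) :
  extreme_points (unit_ball (dual_space Y)) g -> open W -> W g ->
  exists (b : Y) (e : R), 0 < e /\ forall k : dual_space Y,
    `|k| <= 1 -> rnorm b - e < re (k b) -> W k.
Proof.
move=> gext oW Wg; have g1 : `|g| <= 1 by case: gext.
pose F : set_system (weak_star Y) := [set U | exists2 e : R, 0 < e &
  forall d : R, 0 < d -> exists b, rnorm b - d < re (g b) /\
    forall k : dual_space Y, `|k| <= 1 -> rnorm b - e < re (k b) -> U k].
have FF : Filter F.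
  split.
  - exists 1 => // d d0; exists 0; split=> //.
    by rewrite rnorm0 linear0 re_part0; lra.
  - move=> U1 U2 [e1 e10 F1] [e2 e20 F2].
    pose e := Num.min e1 e2; have e0 : 0 < e by rewrite lt_min e10.
    (* As [g] nearly norms both points, [rnorm b1 + rnorm b2] exceeds [rnorm (b1 + b2)] by less than
       [2 c]. Hence the slice of width [e / 2] at the sum lies in the slices of width [e] at [b1]
       and [b2]. *)
    exists (e / 2); first lra.
    move=> d d0; pose c := Num.min (d / 2) (e / 4).
    have c0 : 0 < c by rewrite lt_min; apply/andP; split; lra.
    have [b1 [gb1 U1b]] := F1 c c0; have [b2 [gb2 U2b]] := F2 c c0.
    have cd : c <= d / 2 by rewrite ge_min lexx.
    have ce : c <= e / 4 by rewrite ge_min lexx orbT.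
    have ee1 : e <= e1 by rewrite ge_min lexx.
    have ee2 : e <= e2 by rewrite ge_min lexx orbT.
    have b12 := rnormD b1 b2.
    have gb := re_dual_ball_le (b1 + b2) g1.
    rewrite linearD re_partD in gb.
    exists (b1 + b2); split.
      by rewrite linearD re_partD; lra.
    move=> k k1; rewrite linearD re_partD => kb.
    have kb1 := re_dual_ball_le b1 k1; have kb2 := re_dual_ball_le b2 k1.
    by split; [apply: U1b|apply: U2b] => //; lra.
  - move=> U1 U2 U12 [e e0 F1]; exists e => // d /F1[b [gb Ub]].
    by exists b; split=> // k k1 kb; apply: U12; exact: Ub.
have Fhalf v (e : R) : 0 < e -> F [set k | re ((k : dual_space Y) v) < re (g v) + e].
  move=> e0; exists (e / 2); first lra.
  move=> d d0; pose m := Num.min d (e / 2).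
  have m0 : 0 < m by rewrite lt_min d0; lra.
  have md : m <= d by rewrite ge_min lexx.
  have me : m <= e / 2 by rewrite ge_min lexx orbT.
  (* Here [g] nearly norms both [b] and [v + b]. If [k] nearly norms [b], then [k v], the difference
     of its values at these points, cannot exceed [g v] by much in real part. *)
  have [b bm] := extreme_decomposition v gext m0; exists b.
  have gb := re_dual_ball_le b g1; have gvb := re_dual_ball_le (v + b) g1.
  split; first lra.
  move=> k k1 kb /=; have kvb := re_dual_ball_le (v + b) k1.
  rewrite linearD re_partD in kvb.
  by rewrite linearD re_partD in gvb bm; lra.
have Fg : cvg_to F (nbhs (g : weak_star Y)).
  apply: cvg_weak_star => y e e0.
  have e4 : 0 < e / 2 by lra.
  pose i := @im_unit R cplx.
  have FI := @filterI _ F FF.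
  (* Half-spaces in the directions [y], [- y], [i y] and [- i y] control both the real and the
     imaginary part of [k y - g y]. *)
  have F4 := FI _ _ (FI _ _ (Fhalf y _ e4) (Fhalf (- y) _ e4))
    (FI _ _ (Fhalf (i *: y) _ e4) (Fhalf (- (i *: y)) _ e4)).
  apply: (@filterS _ F FF _ _ _ F4) => k [[/= k1 k2] [/= k3 k4]].
  apply: le_lt_trans (rnorm_le_re _) _.
  have -> : im_unit * (k y - g y) = k (i *: y) - g (i *: y).
    by rewrite !linearZ /= mulrBr scalerN.
  rewrite !re_partD !re_partN; rewrite !linearN !re_partN in k2 k4.
  by rewrite [e]splitr; apply: ltrD; rewrite ltr_norml; apply/andP; split; lra.
have /Fg[e e0 FW] : nbhs (g : weak_star Y) W by exact: open_nbhs_nbhs.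
have [b [_ Wb]] := FW e e0.
by exists b, e.
Qed.

End slices.

(** * Norming triples and the alternative Daugavet property *)

Section alternative_daugavet_triples.
Context {R : realType} {cplx : bool}.
Local Notation K := (scalar_field R cplx).
Local Notation "t %:K" := (of_real cplx t) (at level 2, format "t %:K").
Local Notation re := (@re_part R cplx).
Variables (X Y : normedModType K) (G : bop X Y).

Definition norming_triples := forall (f : dual_space X) (y : Y) (e : R), 0 < e ->
  exists x (g : dual_space Y), [/\ `|x| <= 1, `|g| <= 1, rnorm f - e < rnorm (f x),
    1 - e < rnorm (g (G x)) & rnorm y - e < rnorm (g y)].

(** Rotating [x] makes [f x] positive; rotating [g] afterwards makes [g (G x)] positive and leaves
    the modulus of [g y] unchanged. *)
Lemma norming_triples_re_fG : norming_triples ->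
  forall (f : dual_space X) (y : Y) (e : R), 0 < e ->
  exists x (g : dual_space Y), [/\ `|x| <= 1, `|g| <= 1, rnorm f - e < re (f x),
    1 - e < re (g (G x)) & rnorm y - e < rnorm (g y)].
Proof.
move=> Gt f y e e0; have [x [g [x1 g1 fx gGx gy]]] := Gt f y e e0.
have [w w1 wf] := rotate_re (f x).
have [v v1 vg] := rotate_re (g (G (w *: x))).
exists (w *: x), (v *: g); split.
- by rewrite normrZ w1 mul1r.
- by rewrite normrZ v1 mul1r.
- by rewrite linearZ /= -[w *: _]/(w * _) wf.
- rewrite -[(v *: g) _]/(v * g (G (w *: x))) vg !linearZ /=.
  by rewrite rnorm_unitZ.
- by rewrite -[(v *: g) _]/(v *: g y) rnorm_unitZ.
Qed.

Lemma norming_triples_re_Gy : norming_triples ->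
  forall (f : dual_space X) (y : Y) (e : R), 0 < e ->
  exists x (g : dual_space Y), [/\ `|x| <= 1, `|g| <= 1, rnorm f - e < rnorm (f x),
    1 - e < re (g (G x)) & rnorm y - e < re (g y)].
Proof.
move=> Gt f y e e0; have [x [g [x1 g1 fx gGx gy]]] := Gt f y e e0.
have [v v1 vg] := rotate_re (g y).
have [w w1 wG] := rotate_re (v * g (G x)).
exists (w *: x), (v *: g); split.
- by rewrite normrZ w1 mul1r.
- by rewrite normrZ v1 mul1r.
- by rewrite linearZ /= rnorm_unitZ.
- rewrite -[(v *: g) _]/(v * g (G (w *: x))) !linearZ /=.
  rewrite -[w *: _]/(w * _) mulrCA wG.
  by rewrite rnormM_unit.
- by rewrite -[(v *: g) _]/(v * g y) vg.
Qed.

Hypothesis G1 : `|G| = 1.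

Lemma norm1_op_ball x : `|x| <= 1 -> rnorm (G x) <= 1.
Proof.
move=> x1; move/norm_eq1E : G1; rewrite rnorm_bopE => <-.
exact: le_opnorm_ball.
Qed.

Lemma re_norm1_op_ball x (g : dual_space Y) : `|x| <= 1 -> `|g| <= 1 ->
  re (g (G x)) <= 1.
Proof. by move=> x1 g1; apply: le_trans (re_dual_ball_le _ g1) (norm1_op_ball x1). Qed.

Lemma adjoint_ball (g : dual_space Y) : `|g| <= 1 -> `|adjoint G g| <= 1.
Proof.
move=> g1; rewrite norm_le1E rnorm_bopE; apply: opnorm_le => x x1 /=.
exact: le_trans (dual_ball_le _ g1) (norm1_op_ball x1).
Qed.

Lemma norm1_op_neq0 : exists (f : dual_space X) (y : Y), f != 0 /\ y != 0.
Proof.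
have [x Gx0] : exists x, G x != 0.
  apply: contrapT => nex; have : G = 0.
    apply: val_inj; apply/funext => x /=.
    by apply/eqP/negPn/negP => Gx; apply: nex; exists x.
  by move=> G0; move: G1; rewrite G0 normr0 => /esym/eqP; rewrite oner_eq0.
have [g g1 gGx] := norming (G x).
exists (adjoint G g), (G x); split => //.
apply/eqP => g0; move: Gx0; rewrite -rnorm_eq0 -gGx.
rewrite -[g (G x)]/(adjoint G g x) g0.
by rewrite [X in re X](_ : _ = 0) // re_part0 eqxx.
Qed.

(** A zero [f] or [y] may be replaced by any nonzero one, since its estimate only asks a norm to
    exceed [- e]. This permits rank-one operators and division by [rnorm y]. *)
Lemma norming_triples_neq0 :
  (forall (f : dual_space X) (y : Y) (e : R), f != 0 -> y != 0 -> 0 < e ->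
    exists x (g : dual_space Y), [/\ `|x| <= 1, `|g| <= 1, rnorm f - e < rnorm (f x),
      1 - e < rnorm (g (G x)) & rnorm y - e < rnorm (g y)]) ->
  norming_triples.
Proof.
move=> Gt f y e e0; have [f1 [y1 [f10 y10]]] := norm1_op_neq0.
pose f' := if f == 0 then f1 else f; pose y' := if y == 0 then y1 else y.
have f'0 : f' != 0 by rewrite /f'; case: (eqVneq f 0).
have y'0 : y' != 0 by rewrite /y'; case: (eqVneq y 0).
have [x [g [x1 g1 fx gGx gy]]] := Gt f' y' e f'0 y'0 e0.
exists x, g; split => //.
  move: fx; rewrite /f'; case: (eqVneq f 0) => [->|//] _.
  by rewrite rnorm0 sub0r (lt_le_trans _ (rnorm_ge0 _)) // oppr_lt0.
move: gy; rewrite /y'; case: (eqVneq y 0) => [->|//] _.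
by rewrite rnorm0 sub0r (lt_le_trans _ (rnorm_ge0 _)) // oppr_lt0.
Qed.

Fact rank_one_op_subproof (f : dual_space X) (y : Y) :
  (fun x => f x *: y) \in bop_pred X Y.
Proof.
apply/asboolP; split; first by move=> a u v; rewrite linearP scalerDl scalerA.
by move=> x; apply: cvgZr_tmp; exact: dual_continuous.
Qed.

Definition rank_one_op (f : dual_space X) (y : Y) : bop X Y :=
  Bop (rank_one_op_subproof f y).

Lemma rank_one_opP (f : dual_space X) (y : Y) : f != 0 -> y != 0 ->
  rank_one (rank_one_op f y).
Proof.
move=> f0 y0; exists y => //; apply/seteqP; split => [_ [x _ <-]|_ [a _ <-]].
  by exists (f x).
have [x fx] : exists x, f x != 0.
  apply: contrapT => nex; case/eqP: f0; apply: val_inj; apply/funext => x /=.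
  by apply/eqP/negPn/negP => fx; apply: nex; exists x.
by exists (a / f x *: x) => //=; rewrite linearZ /= -[_ *: f x]/(_ * f x) divfK.
Qed.

Lemma rnorm_rank_one_op (f : dual_space X) (y : Y) :
  rnorm (rank_one_op f y) = rnorm f * rnorm y.
Proof.
rewrite !rnorm_bopE; apply: sup_eq => [_ [x x1 <-] /=|e e0].
  by rewrite rnormZ ler_wpM2r ?rnorm_ge0 // le_opnorm_ball.
pose c := rnorm y + 1; have c0 : 0 < c by have := rnorm_ge0 y; rewrite /c; lra.
have [_ [x x1 <-] fx] := sup_adherent (divr_gt0 e0 c0) (bop_has_sup f).
exists (rnorm (rank_one_op f y x)); first by exists x.
rewrite /= rnormZ -[re_part _]/(rnorm (f x)).
have := ler_wpM2r (rnorm_ge0 y) (ltW fx); rewrite mulrBl -/(opnorm f).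
have : e / c * rnorm y < e.
  by rewrite -mulrA gtr_pMr // ltr_pdivrMl // mulr1 /c; lra.
by lra.
Qed.

(** For the rank-one operator of [f] and [y], take [x] nearly norming [G + w T] and [g] norming its
    value there. A sum close to its largest possible value has all its terms and factors close to
    theirs. *)
Lemma alternative_daugavet_triples : alternative_daugavet G -> norming_triples.
Proof.
move=> aG; apply: norming_triples_neq0 => f y e f0 y0 e0.
have Nf : 0 < rnorm f by rewrite lt_neqAle rnorm_ge0 eq_sym rnorm_eq0 f0.
have Ny : 0 < rnorm y by rewrite lt_neqAle rnorm_ge0 eq_sym rnorm_eq0 y0.
(* The error in the product [rnorm (f x) * rnorm (g y)] is later divided by [rnorm y] or by
   [rnorm f]. *)
pose d := Num.min e (Num.min (e * rnorm f) (e * rnorm y)).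
have d0 : 0 < d by rewrite !lt_min e0 !mulr_gt0.
have de : d <= e by rewrite ge_min lexx.
have df : d <= e * rnorm f by rewrite !ge_min lexx orbT.
have dy : d <= e * rnorm y by rewrite !ge_min lexx !orbT.
have d20 : 0 < d / 2 by lra.
have fy0 : 0 < rnorm f * rnorm y by exact: mulr_gt0.
have := aG _ (rank_one_opP f0 y0); rewrite rnorm_rank_one_op.
move=> /sup_eq_gt/(_ _ d20)[|_ [w w1 <-] wGT]; first lra.
have [_ [x x1 <-] xGT] := sup_adherent d20 (bop_has_sup (G + w *: rank_one_op f y)).
have {wGT}xGT : 1 + rnorm f * rnorm y - d < rnorm (G x + (w * f x) *: y).
  move: xGT; rewrite -/(opnorm _) -rnorm_bopE.
  rewrite -[(G + _) x]/(G x + w *: (f x *: y)) scalerA.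
  by move: wGT; lra.
have [g g1 gx] := norming (G x + (w * f x) *: y).
have GxN : rnorm (g (G x)) <= 1 by apply: le_trans (dual_ball_le _ g1) (norm1_op_ball x1).
have gyN := dual_ball_le y g1.
have fxN : rnorm (f x) <= rnorm f by rewrite rnorm_bopE le_opnorm_ball.
have key : 1 + rnorm f * rnorm y - d < rnorm (g (G x)) + rnorm (f x) * rnorm (g y).
  apply: lt_le_trans xGT _; rewrite -gx linearD re_partD linearZ /=.
  apply: lerD; first exact: re_part_le_norm.
  apply: le_trans (re_part_le_norm _) _.
  by rewrite rnormZ -[re_part _]/(rnorm (w *: (f x : K^o))) rnorm_unitZ.
have n1 := rnorm_ge0 (f x); have n2 := rnorm_ge0 (g y).
have a1 : rnorm (f x) * rnorm (g y) <= rnorm f * rnorm y by exact: ler_pM.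
have a2 : rnorm (f x) * rnorm (g y) <= rnorm (f x) * rnorm y by rewrite ler_wpM2l.
have a3 : rnorm (f x) * rnorm (g y) <= rnorm f * rnorm (g y) by rewrite ler_wpM2r.
exists x, g; split => //.
- by rewrite -(ltr_pM2r Ny) mulrBl; lra.
- by lra.
- by rewrite -(ltr_pM2l Nf) mulrBr; lra.
Qed.

(** As [T] takes values in the line of [y], a functional [g0] norming [y] preserves the norm of
    every [T x]; so the triple is taken for [adjoint T g0] and [y]. *)
Lemma triples_alternative_daugavet : norming_triples -> alternative_daugavet G.
Proof.
move=> Gt T [y y0 Ty].
have NG : rnorm G = 1 by apply/norm_eq1E.
apply: sup_eq => [_ [w w1 <-]|e e0].
  by apply: le_trans (rnormD _ _) _; rewrite NG rnorm_unitZ.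
have Ny : 0 < rnorm y by rewrite lt_neqAle rnorm_ge0 eq_sym rnorm_eq0 y0.
have [g0 g01 g0y] := norming y.
have Tx x : exists a : K, a *: y = T x.
  by have : range T (T x) by [exists x]; rewrite Ty => -[a _]; exists a.
have NT : rnorm T <= rnorm (adjoint T g0).
  rewrite [leLHS]rnorm_bopE; apply: opnorm_le => x x1.
  apply: le_trans (_ : rnorm (adjoint T g0 x) <= _); last first.
    by rewrite rnorm_bopE le_opnorm_ball.
  rewrite /=; have [a <-] := Tx x; rewrite linearZ /= !rnormZ.
  by rewrite ler_wpM2l ?(@rnorm_ge0 _ _ K^o a) // -g0y re_part_le_norm.
(* The estimates at [g (G x)] and at [adjoint T g0] cost [e / c] each; the one at [g y] is
   multiplied by [n], which is at most [rnorm T / rnorm y]. *)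
pose c := 2 + rnorm T / rnorm y.
have Tn := rnorm_ge0 T.
have c0 : 0 < c by rewrite /c ltr_wpDr // divr_ge0 // rnorm_ge0.
have ec0 : 0 < e / c by rewrite divr_gt0.
have [x [g [x1 g1 fx gGx gy]]] := Gt (adjoint T g0) y (e / c) ec0.
have [a Ta] := Tx x.
pose n := rnorm (a : K^o).
have n0 : 0 <= n by exact: rnorm_ge0.
have Tan : rnorm (T x) = n * rnorm y by rewrite -Ta rnormZ.
have nT : n <= rnorm T / rnorm y.
  by rewrite ler_pdivlMr // -Tan rnorm_bopE le_opnorm_ball.
have fxT : rnorm (adjoint T g0 x) <= n * rnorm y by rewrite -Tan; exact: (dual_ball_le (T x) g01).
(* The rotation [u] is absorbed into the functional [g], while [v] is the unimodular coefficient of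
   [T]. *)
have [u u1 uG] := rotate_re (g (G x)).
have [v v1 vT] := rotate_re (u * (g (T x))).
have w1 : unimodular v by [].
exists (rnorm (G + v *: T)); first by exists v.
have gT : rnorm (g (T x)) = n * rnorm (g y).
  by rewrite -Ta linearZ /= rnormZ.
have : rnorm (g (G x)) + rnorm (g (T x)) <= rnorm (G + v *: T).
  apply: le_trans (_ : rnorm ((G + v *: T) x) <= _); last first.
    by rewrite [leRHS]rnorm_bopE le_opnorm_ball.
  have ug1 : `|u *: g| <= 1 by rewrite normrZ u1 mul1r.
  apply: le_trans (re_dual_ball_le _ ug1).
  rewrite -[(u *: g) _]/(u * g (G x + v *: T x)) linearD linearZ /= mulrDr.
  rewrite re_partD uG -[v *: _]/(v * _) mulrCA vT.
  by rewrite rnormM_unit.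
have : n * (rnorm y - e / c) <= n * rnorm (g y) by rewrite ler_wpM2l // ltW.
have : n * (e / c) <= rnorm T / rnorm y * (e / c) by rewrite ler_wpM2r // ltW.
have : e / c * c = e by rewrite divfK // gt_eqF.
by rewrite gT {2}/c mulrDr mulrBr [_ / _ * (e / c)]mulrC; lra.
Qed.

End alternative_daugavet_triples.

(** * Slices, spear sets and closed convex hulls *)

Section slice_characterizations.
Context {R : realType} {cplx : bool}.
Local Notation K := (scalar_field R cplx).
Local Notation "t %:K" := (of_real cplx t) (at level 2, format "t %:K").
Local Notation re := (@re_part R cplx).
Variables (X Y : normedModType K) (G : bop X Y).
Variables (B : set X) (A : set (dual_space Y)).
Hypothesis G1 : `|G| = 1.
Hypothesis B1 : B `<=` unit_ball X.
Hypothesis B_hull : unit_ball X = closure (convex_hull B).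
Hypothesis A1 : A `<=` unit_ball (dual_space Y).
Hypothesis A_hull :
  closure (convex_hull A : set (weak_star Y)) = unit_ball (dual_space Y).

(** Otherwise [C], and with it the closed convex hull, would lie in the closed half-space where
    [re (f b) <= c]. *)
Lemma hull_gt (f : dual_space X) (C : set X) (c : R) (x : X) :
  unit_ball X = closure (convex_hull C) ->
  `|x| <= 1 -> c < re (f x) -> exists2 b, C b & c < re (f b).
Proof.
move=> C_hull x1 cx; apply: contrapT => nex; move: cx; apply/negP; rewrite -leNgt.
have xC : closure (convex_hull C) x by rewrite -C_hull.
apply: (re_le_closure (@dual_continuous _ _ _ f) _ xC).
apply: (convex_hull_halfspace (re_dual_linear f)) => b Cb.
by rewrite leNgt; apply/negP => cb; apply: nex; exists b.
Qed.

Lemma weak_star_hull_gt (y : Y) (c : R) (g : dual_space Y) :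
  `|g| <= 1 -> c < re (g y) -> exists2 a, A a & c < re (a y).
Proof.
move=> g1 cg; apply: contrapT => nex; move: cg; apply/negP; rewrite -leNgt.
have gA : closure (convex_hull A : set (weak_star Y)) g by rewrite A_hull.
apply: (re_le_closure (@weak_star_eval_continuous _ _ _ y) _ gA).
have evl : real_linear (fun k : dual_space Y => re (k y)).
  move=> t k l; rewrite -[(_ + _ : dual_space Y) y]/(t%:K * k y + l y).
  by rewrite re_partD re_partZ.
apply: (convex_hull_halfspace evl) => a Aa.
by rewrite leNgt; apply/negP => ca; apply: nex; exists a.
Qed.

Lemma ball_re_gt (f : dual_space X) (e : R) : 0 < e ->
  exists2 x, `|x| <= 1 & rnorm f - e < re (f x).
Proof.
move=> e0; have [_ [x x1 <-] xe] := sup_adherent e0 (bop_has_sup f).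
have [w w1 wf] := rotate_re (f x); exists (w *: x).
  by rewrite normrZ w1 mul1r.
by rewrite linearZ /= -[w *: _]/(w * _) wf rnorm_bopE.
Qed.

Lemma sup_re_B (f : dual_space X) : sup [set re (f x) | x in B] = rnorm f.
Proof.
apply: sup_eq => [_ [x /B1 x1 <-]|e e0].
  apply: le_trans (re_part_le_norm _) _.
  by rewrite rnorm_bopE; exact: le_opnorm_ball.
have [x x1 fx] := ball_re_gt f e0.
have [b Bb fb] := hull_gt B_hull x1 fx.
by exists (re (f b)) => //; exists b.
Qed.

Lemma sup_re_A (y : Y) : sup [set re (g y) | g in A] = rnorm y.
Proof.
apply: sup_eq => [_ [g /A1 g1 <-]|e e0]; first exact: re_dual_ball_le.
have [g g1 gy] := norming y.
have [|a Aa ay] := @weak_star_hull_gt y (rnorm y - e) g g1.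
  by rewrite gy ltrBlDr ltrDl.
by exists (re (a y)) => //; exists a.
Qed.

Lemma triples_spear_slices : norming_triples G ->
  forall S : set X, is_slice B S -> spear_set (G @` S).
Proof.
move=> Gt S [f [a [a0 ->]]].
have SB x : (B x /\ re (f x) > sup [set re (f y) | y in B] - a) -> `|x| <= 1.
  by case=> /B1.
split=> [_ [x /SB x1 <-]|y].
  by rewrite /unit_ball /= norm_le1E; exact: norm1_op_ball.
apply: sup_eq => [_ [_ [x /SB x1 <-] [w w1 <-]]|e e0].
  apply: le_trans (rnormD _ _) _; rewrite rnorm_unitZ // lerD2r.
  exact: norm1_op_ball.
(* For the point [b] found below, [f b] and [g (G b)] each lose at most [2 d]: the first must stay
   within [a], and the second plus the loss [d] at [g y] within [e]. *)
pose d := Num.min (a / 2) (e / 3).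
have d0 : 0 < d by rewrite lt_min; apply/andP; split; lra.
have da : d <= a / 2 by rewrite ge_min lexx.
have de : d <= e / 3 by rewrite ge_min lexx orbT.
have [x [g [x1 g1 fx gGx gy]]] := norming_triples_re_fG Gt f y d0.
have [|b Bb] := @hull_gt (adjoint G g + f) B (1 + rnorm f - 2 * d) x B_hull x1.
  by rewrite -[(_ + f) x]/(g (G x) + f x) re_partD; lra.
rewrite -[(_ + f) b]/(g (G b) + f b) re_partD => gfb.
have b1 := B1 Bb.
have gGb := re_norm1_op_ball G1 b1 g1.
have fb : re (f b) <= rnorm f.
  apply: le_trans (re_part_le_norm _) _.
  by rewrite rnorm_bopE; exact: le_opnorm_ball.
have [w w1 wg] := rotate_re (g y).
exists (rnorm (G b + w *: y)).
  exists (G b); last by exists w.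
  by exists b => //; split=> //; rewrite sup_re_B; lra.
apply: lt_le_trans (re_dual_ball_le _ g1).
by rewrite linearD linearZ /= re_partD -[w *: _]/(w * _) wg; lra.
Qed.

(** The slice cut by [f] with width [e] controls [f x]; the spear property at [y] and a functional
    norming [G x + w y] control the other two values. *)
Lemma spear_slices_triples :
  (forall S : set X, is_slice B S -> spear_set (G @` S)) -> norming_triples G.
Proof.
move=> GS f y e e0.
have [_ /(_ y)] := GS _ (ex_intro _ f (ex_intro _ e (conj e0 erefl))).
have y0 : 0 < 1 + rnorm y by rewrite ltr_pwDl // rnorm_ge0.
move=> /sup_eq_gt/(_ y0 e0)[_ [_ [x [Bx fx] <-] [w w1 <-]] Gxy].
have x1 := B1 Bx; rewrite sup_re_B in fx.
have [g g1 gxy] := norming (G x + w *: y).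
exists x, g.
have GxN : rnorm (g (G x)) <= 1.
  by apply: le_trans (dual_ball_le _ g1) (norm1_op_ball G1 x1).
have gyN := dual_ball_le y g1.
have : 1 + rnorm y - e < rnorm (g (G x)) + rnorm (g y).
  apply: lt_le_trans Gxy _; rewrite -gxy linearD re_partD linearZ /=.
  apply: lerD; first exact: re_part_le_norm.
  by apply: le_trans (re_part_le_norm _) _; rewrite rnorm_unitZ.
have := re_part_le_norm (f x).
by split => //; lra.
Qed.

Lemma triples_spear_weak_star_slices : norming_triples G ->
  forall S : set (dual_space Y), is_weak_star_slice A S -> spear_set (adjoint G @` S).
Proof.
move=> Gt S [y [a [a0 ->]]].
have SA (g : dual_space Y) : (A g /\ re (g y) > sup [set re (h y) | h in A] - a) -> `|g| <= 1.
  by case=> /A1.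
split=> [_ [g /SA g1 <-]|f]; first exact: adjoint_ball.
apply: sup_eq => [_ [_ [g /SA g1 <-] [w w1 <-]]|e e0].
  apply: le_trans (rnormD _ _) _; rewrite rnorm_unitZ // lerD2r.
  by rewrite -norm_le1E; exact: adjoint_ball.
pose d := Num.min (a / 2) (e / 3).
have d0 : 0 < d by rewrite lt_min; apply/andP; split; lra.
have da : d <= a / 2 by rewrite ge_min lexx.
have de : d <= e / 3 by rewrite ge_min lexx orbT.
have [x [g [x1 g1 fx gGx gy]]] := norming_triples_re_Gy Gt f y d0.
(* With [x] fixed, the two values to keep add up to the evaluation at [G x + y], which depends on
   the functional alone. *)
have [|b Ab] := @weak_star_hull_gt (G x + y) (1 + rnorm y - 2 * d) g g1.
  by rewrite linearD re_partD; lra.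
rewrite linearD re_partD => bGxy.
have b1 := A1 Ab.
have bGx := re_norm1_op_ball G1 x1 b1.
have bey := re_dual_ball_le y b1.
have [w w1 wf] := rotate_re (f x).
exists (rnorm (adjoint G b + w *: f)).
  exists (adjoint G b); last by exists w.
  by exists b => //; split=> //; rewrite sup_re_A; lra.
rewrite [ltRHS]rnorm_bopE; apply: lt_le_trans (le_opnorm_ball (adjoint G b + w *: f) x1).
apply: lt_le_trans (re_part_le_norm _).
rewrite -[(_ + _ : dual_space X) x]/(b (G x) + w * f x).
by rewrite re_partD wf; lra.
Qed.

Lemma norm_adjoint_triples (y : Y) (f : dual_space X) (g : dual_space Y) (w : K)
    (e : R) : `|g| <= 1 -> `|w| = 1 -> rnorm y - e < re (g y) ->
  1 + rnorm f - e < rnorm (adjoint G g + w *: f) ->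
  exists x (g : dual_space Y), [/\ `|x| <= 1, `|g| <= 1, rnorm f - e < rnorm (f x),
    1 - e < rnorm (g (G x)) & rnorm y - e < rnorm (g y)].
Proof.
move=> g1 w1 gy; rewrite [ltRHS]rnorm_bopE => Ggf.
have [|_ [x x1 <-]] := sup_gt _ Ggf; first exact: (bop_has_sup _).1.
rewrite -[(_ + _ : dual_space X) x]/(g (G x) + w *: f x) => gfx.
exists x, g.
have := rnormD (g (G x)) (w *: f x); rewrite rnorm_unitZ //.
have : rnorm (g (G x)) <= 1.
  by apply: le_trans (dual_ball_le _ g1) (norm1_op_ball G1 x1).
have : rnorm (f x) <= rnorm f by rewrite rnorm_bopE; exact: le_opnorm_ball.
have := re_part_le_norm (g y).
by split => //; lra.
Qed.

Lemma spear_weak_star_slices_triples :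
  (forall S : set (dual_space Y), is_weak_star_slice A S -> spear_set (adjoint G @` S)) ->
  norming_triples G.
Proof.
move=> GS f y e e0.
have [_ /(_ f)] := GS _ (ex_intro _ y (ex_intro _ e (conj e0 erefl))).
have f0 : 0 < 1 + rnorm f by rewrite ltr_pwDl // rnorm_ge0.
move=> /sup_eq_gt/(_ f0 e0)[_ [_ [g [Ag gy] <-] [w w1 <-]] Ggf].
rewrite sup_re_A in gy.
exact: (norm_adjoint_triples (A1 Ag) w1 gy Ggf).
Qed.

Definition nearly_additive (y : Y) (e : R) : set X :=
  [set x | B x /\ 2 - e < sup [set rnorm (G x + w *: y) | w in unimodular]].

(** Every slice of [B] meets [nearly_additive y e], whereas a point of the ball outside the closed
    hull would be separated from it by a slice that misses it. *)
Lemma spear_slices_hull :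
  (forall S : set X, is_slice B S -> spear_set (G @` S)) ->
  forall (y : Y) (e : R), unit_sphere Y y -> 0 < e ->
    unit_ball X = closure (convex_hull (nearly_additive y e)).
Proof.
move=> GS y e /norm_eq1E y1 e0.
have large S : is_slice B S -> exists2 x, S x & nearly_additive y e x.
  move=> BS; have [f [a [_ SE]]] := BS; have [_ /(_ y)] := GS S BS.
  rewrite y1; have two0 : 0 < 1 + 1 :> R by [].
  move=> /sup_eq_gt/(_ two0 e0)[_ [_ [x Sx <-] [w w1 <-]] Gxy].
  have Bx : B x by move: Sx; rewrite SE => -[].
  exists x => //; split => //; apply: lt_le_trans Gxy _.
  apply: ub_le_sup; last by exists w.
  exists (1 + 1) => _ [v v1 <-]; apply: le_trans (rnormD _ _) _.
  by rewrite rnorm_unitZ // y1 lerD2r; apply: norm1_op_ball => //; exact: B1.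
have BE : nearly_additive y e `<=` B by move=> x [].
apply/seteqP; split => [x1 x1b|]; last first.
  rewrite B_hull; apply: closureS => z zl C [cC BC].
  by apply: zl; split=> // b /BE; exact: BC.
apply: contrapT => x1n.
have [r r0 rD] : exists2 r : R, 0 < r &
    forall d, convex_hull (nearly_additive y e) d -> r <= rnorm (x1 - d).
  apply: contrapT => nex; apply: x1n => U /nbhs_ballP[r r0 rU].
  have rE : r = (re r)%:K by rewrite reK // ltW.
  apply: contrapT => nU; apply: nex; exists (re r).
    by rewrite -(lt_of_real (cplx := cplx)) of_real0 -rE.
  move=> d dD; rewrite leNgt; apply/negP => dr; apply: nU; exists d; split => //.
  by apply: rU; rewrite -ball_normE /ball_ /= rE -of_rnorm lt_of_real.
(* Separation needs a nonempty set; the slice cut by the zero functional provides a point. *)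
have [b0 _ b0l] : exists2 x, B x & nearly_additive y e x.
  have [|x [Bx _] xl] := large [set x | B x /\ re ((0 : dual_space X) x) >
      sup [set re ((0 : dual_space X) y) | y in B] - 1].
    by exists 0, 1.
  by exists x.
pose D := [set x1 - d | d in convex_hull (nearly_additive y e)].
have D0 : D !=set0.
  by exists (x1 - b0), b0 => //; exact: sub_gen_smallest.
have cD : real_convex D.
  move=> _ _ t [d1 D1 <-] [d2 D2 <-] t01.
  exists (t%:K *: d1 + (1 - t)%:K *: d2); first exact: convex_hull_real_convex.
  rewrite !scalerBr addrACA -opprD -scalerDl -of_realD subrKC of_real1.
  by rewrite scale1r.
have rD' d : D d -> r <= rnorm d by move=> [c /rD cr <-].
have [f f1 fD] := separation D0 cD rD'.
(* This width places the edge of the slice at [re (f x1) - r], which [f] does not exceed on the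
   hull. *)
pose a := rnorm f - (re (f x1) - r).
have fx1 : re (f x1) <= rnorm f.
  apply: le_trans (re_part_le_norm _) _.
  by rewrite rnorm_bopE; exact: le_opnorm_ball.
have a0 : 0 < a by rewrite /a; lra.
have [|x [Bx]] := large [set x | B x /\ re (f x) > sup [set re (f y) | y in B] - a].
  by exists f, a.
rewrite sup_re_B /a => fx xl.
have := fD (x1 - x); rewrite linearB re_partD re_partN => fxx.
have : r <= re (f x1) - re (f x).
  by apply: fxx; exists x => //; exact: sub_gen_smallest.
by lra.
Qed.

Lemma hull_triples :
  (forall (y : Y) (e : R), unit_sphere Y y -> 0 < e ->
    unit_ball X = closure (convex_hull (nearly_additive y e))) ->
  norming_triples G.
Proof.
move=> hull; apply: norming_triples_neq0 => // f y e f0 y0 e0.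
have Ny : 0 < rnorm y by rewrite lt_neqAle rnorm_ge0 eq_sym rnorm_eq0 y0.
pose y1 := (rnorm y)^-1%:K *: y.
have Ny1 : rnorm y1 = 1.
  by rewrite rnorm_of_realZ ger0_norm ?invr_ge0 ?ltW // mulVf // gt_eqF.
have yE : y = (rnorm y)%:K *: y1.
  by rewrite scalerA -of_realM mulfV ?gt_eqF // of_real1 scale1r.
(* The hypothesis concerns the unit vector [y1]; returning to [y] multiplies the error by
   [rnorm y]. *)
pose d := Num.min e (e / rnorm y).
have d0 : 0 < d by rewrite lt_min e0 divr_gt0.
have de : d <= e by rewrite ge_min lexx.
have dy : d * rnorm y <= e by rewrite -ler_pdivlMr // ge_min lexx orbT.
have /hull/(_ d0) hullx : unit_sphere Y y1 by apply/norm_eq1E.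
have [x x1 fx] := ball_re_gt f d0.
have [b [Bb]] := hull_gt hullx x1 fx.
have b1 := B1 Bb.
move=> /sup_gt[|_ [w w1 <-] Gby fb].
  by exists (rnorm (G b + 1 *: y1)), 1 => //; rewrite /unimodular /= normr1.
have [g g1 gby] := norming (G b + w *: y1).
have GbN : rnorm (g (G b)) <= 1.
  by apply: le_trans (dual_ball_le _ g1) (norm1_op_ball G1 b1).
have gyN := dual_ball_le y1 g1.
have key : 2 - d < rnorm (g (G b)) + rnorm (g y1).
  apply: lt_le_trans Gby _; rewrite -gby linearD re_partD linearZ /=.
  apply: lerD; first exact: re_part_le_norm.
  by apply: le_trans (re_part_le_norm _) _; rewrite rnorm_unitZ.
have gy : rnorm (g y) = rnorm y * rnorm (g y1).
  by rewrite {1}yE linearZ /= rnorm_of_realZ ger0_norm // ltW.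
exists b, g; split => //.
- by have := re_part_le_norm (f b); lra.
- by lra.
- rewrite gy; apply: le_lt_trans (_ : _ <= rnorm y * (1 - d)) _.
    by rewrite mulrBr mulr1 (mulrC (rnorm y)); lra.
  by rewrite ltr_pM2l //; lra.
Qed.

End slice_characterizations.

(** * Perturbing a vector along a convergent series *)

Section perturbation.
Context {R : realType} {cplx : bool}.
Local Notation K := (scalar_field R cplx).
Local Notation "t %:K" := (of_real cplx t) (at level 2, format "t %:K").
Local Notation re := (@re_part R cplx).
Variables (X : normedModType K) (Y : completeNormedModType K) (G : bop X Y).
Hypothesis G1 : `|G| = 1.

Lemma natSinv_lt (e : R) : 0 < e -> exists n : nat, n.+1%:R^-1 < e.
Proof.
move=> e0; have [N _ /(_ N (leqnn N))] := near_infty_natSinv_lt (PosNum e0).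
by exists N.
Qed.

Lemma limit_of_tails (v : nat -> Y) (s : nat -> R) :
  (forall n k, rnorm (v (n + k)%N - v n) <= s n) ->
  (forall e : R, 0 < e -> exists n, s n < e) ->
  exists l, forall n, rnorm (l - v n) <= s n.
Proof.
move=> vs s_small.
have vc : cvg (v @ \oo).
  apply/cauchy_cvgP/cauchy_exP => e e0.
  have eE : e = (re e)%:K by rewrite reK // ltW.
  have [|n sn] := s_small (re e).
    by rewrite -(lt_of_real (cplx := cplx)) of_real0 -eE.
  exists (v n); exists n => // m /= nm; rewrite -ball_normE /ball_ /= distrC.
  rewrite eE -of_rnorm lt_of_real -(subnKC nm).
  exact: le_lt_trans (vs _ _) sn.
exists (lim (v @ \oo)) => n; apply/ler_addgt0Pr => e e0.
have e0K : 0 < e%:K :> K by rewrite -(of_real0 (cplx := cplx)) lt_of_real.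
have /cvgrPdist_lt/(_ _ e0K)[N _ vN] := vc.
have := vN (n + N)%N (leq_addl _ _); rewrite /= -of_rnorm lt_of_real => /ltW lv.
rewrite [leRHS]addrC -[lim _ - v n](subrKA (v (n + N)%N)).
by apply: le_trans (rnormD _ _) (lerD lv (vs n N)).
Qed.

Lemma norming_triples_step (f : dual_space X) (y : Y) (c e : R) :
  norming_triples G -> 0 < c -> 0 < e ->
  exists x, [/\ `|x| <= 1, rnorm f - e < rnorm (f x) &
    rnorm y + c * (1 - e) <= rnorm (y + c%:K *: G x)].
Proof.
move=> Gt c0 e0; have c1 : 0 < 1 + c by lra.
(* The value of [g] at [y + c G x] loses [d] from [y] and [c * d] from [G x], together at most
   [c * e]. *)
pose d := Num.min e (c * e / (1 + c)).
have d0 : 0 < d by rewrite lt_min e0 divr_gt0 // mulr_gt0.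
have de : d <= e by rewrite ge_min lexx.
have dce : d * (1 + c) <= c * e by rewrite -ler_pdivlMr // ge_min lexx orbT.
have [x [g [x1 g1 fx gGx gy]]] := norming_triples_re_Gy Gt f y d0.
exists x; split => //; first lra.
apply: le_trans (re_dual_ball_le _ g1).
rewrite linearD linearZ /= re_partD re_partZ.
have : c * (1 - d) <= c * re (g (G x)) by rewrite ler_pM2l // ltW.
by lra.
Qed.

(* Along [y_(n+1) = y_n + c_n G x_n] with [c_n = d / (n+1)! - d / (n+2)!], the
   remainder of the series after step [n] is negligible with respect to [c_n],
   so a functional norming the limit has to be close to [1] at [G x_n]. *)
Lemma norming_perturbation (f : dual_space X) (y : Y) (d : R) :
  norming_triples G -> 0 < d ->
  exists2 z : Y, rnorm (z - y) <= d &
    forall g : dual_space Y, `|g| <= 1 -> re (g z) = rnorm z ->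
    forall e : R, 0 < e -> exists x, [/\ `|x| <= 1, rnorm f - e < rnorm (f x) &
      1 - e < re (g (G x))].
Proof.
move=> Gt d0.
(* With factorials the increment [s n - s n.+1] is [n.+1] times the remaining length [s n.+1]. *)
pose s n : R := d / n.+1`!%:R.
have s0 n : 0 < s n by rewrite divr_gt0 // ltr0n fact_gt0.
have sS n : s n = n.+2%:R * s n.+1.
  by rewrite /s [n.+2`!]factS natrM invfM mulrCA mulVKf // pnatr_eq0.
have cE n : s n - s n.+1 = n.+1%:R * s n.+1.
  by rewrite sS -[n.+2%:R]natr1 mulrDl mul1r addrK.
have c0 n : 0 < s n - s n.+1 by rewrite cE mulr_gt0.
have inv0 n : 0 < n.+1%:R^-1 :> R by rewrite invr_gt0.
(* Choosing for all pairs of an index and a current point at once lets the sequence be defined by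
   plain recursion; the error at step [n] is [n.+1%:R^-1]. *)
have [u uP] := choice (fun p : nat * Y =>
  norming_triples_step f p.2 Gt (c0 p.1) (inv0 p.1)).
pose fix v n : Y := if n is m.+1 then v m + (s m - s m.+1)%:K *: G (u (m, v m)) else y.
have vS n : v n.+1 = v n + (s n - s n.+1)%:K *: G (u (n, v n)) by [].
have v_tail n k : rnorm (v (n + k)%N - v n) <= s n - s (n + k)%N.
  elim: k => [|k IH]; first by rewrite addn0 !subrr rnorm0.
  rewrite addnS vS addrAC.
  have [u1 _ _] := uP ((n + k)%N, v (n + k)%N).
  have := rnormD (v (n + k)%N - v n)
    ((s (n + k)%N - s (n + k).+1)%:K *: G (u ((n + k)%N, v (n + k)%N))).
  rewrite rnorm_of_realZ gtr0_norm //.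
  have : (s (n + k)%N - s (n + k).+1) * rnorm (G (u ((n + k)%N, v (n + k)%N))) <=
      s (n + k)%N - s (n + k).+1.
    by apply: ler_piMr; [exact: ltW|exact: (norm1_op_ball G1 u1)].
  by move: IH; lra.
have [||z zv] := @limit_of_tails v s.
- by move=> n k; apply: le_trans (v_tail n k) _; rewrite gerBl ltW.
- move=> e e0; have [n nd] := natSinv_lt (divr_gt0 e0 d0).
  exists n; rewrite /s; apply: le_lt_trans (_ : d * n.+1%:R^-1 < e).
    rewrite ler_pM2l // lef_pV2 ?posrE ?ltr0n ?fact_gt0 // ler_nat.
    by rewrite factS leq_pmulr // fact_gt0.
  by rewrite -ltr_pdivlMl // mulrC.
exists z; first by have := zv 0%N; rewrite /s divr1.
move=> g g1 gz e e0.
have e3 : 0 < e / 3 by lra.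
have [n ne] := natSinv_lt e3.
have [x1 fx vx] := uP (n, v n); rewrite /= -vS in x1 fx vx.
have {}fx : rnorm f - e < rnorm (f (u (n, v n))).
  by apply: lt_trans fx; rewrite ltrD2l ltrN2; apply: lt_trans ne _; lra.
exists (u (n, v n)); split => //.
have gvn := re_dual_ball_le (v n) g1.
have gzn := re_dual_ball_le (z - v n.+1) g1.
have zn : rnorm (v n.+1) - rnorm z <= rnorm (z - v n.+1).
  by rewrite -(rnormN (z - _)) opprB -[rnorm z]rnormN; exact: ler_rnormB.
have zva := zv n.+1.
have gv : re (g (v n.+1)) =
    re (g (v n)) + (s n - s n.+1) * re (g (G (u (n, v n)))).
  by rewrite vS linearD linearZ /= re_partD re_partZ.
rewrite linearB re_partD re_partN gz gv in gzn.
rewrite cE in gzn vx.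
have a0 := s0 n.+1.
set a := s n.+1 in a0 gzn vx zva *; set t := re (g (G _)) in gzn *.
set m := n.+1%:R in ne vx gzn; have m0 : 0 < m by rewrite ltr0n.
have mV : m * a * (1 - m^-1) = m * a - a by rewrite mulrBr mulr1 mulrAC mulfV ?mul1r ?gt_eqF.
rewrite mV in vx.
(* The three losses of [a] are: the error of step [n], the gap between the norms of [v n.+1] and
   [z], and the gap between [g] at these two points. *)
have : a * (m * t) >= a * (m - 3).
  by move: gzn zn zva gvn vx; rewrite mulrBr; lra.
rewrite ler_pM2l // => mt.
rewrite -(ltr_pM2l m0); apply: lt_le_trans mt.
rewrite mulrBr mulr1 ltrD2l ltrN2 -ltr_pdivrMl //.
by rewrite -ltr_pdivlMr.
Qed.

End perturbation.

(** * Norm-additive extreme functionals as a dense G-delta set *)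

Section norm_additive_functionals.
Context {R : realType} {cplx : bool}.
Local Notation K := (scalar_field R cplx).
Local Notation "t %:K" := (of_real cplx t) (at level 2, format "t %:K").
Local Notation re := (@re_part R cplx).

Lemma open_weak_star_halfspace (Y : normedModType K) (y : Y) (c : R) :
  open [set k : weak_star Y | c < re ((k : dual_space Y) y)].
Proof.
rewrite openE => g /= cg; rewrite /interior /=.
have e0 : 0 < (re ((g : dual_space Y) y) - c)%:K :> K.
  by rewrite -(of_real0 (cplx := cplx)) lt_of_real subr_gt0.
have /cvgrPdist_lt/(_ _ e0) := @weak_star_eval_continuous _ _ _ y g.
apply: filterS => k /=; rewrite -of_rnorm lt_of_real => gk.
have := le_lt_trans (re_part_le_norm _) gk.
by rewrite re_partD re_partN; lra.
Qed.

(** Exceeding [1 + rnorm f - n.+1%:R^-1] is witnessed by one scalar [w] and one vector [x], so it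
    defines a union of weak-star open half-spaces. *)
Lemma norm_additive_Gdelta (X Y : normedModType K) (G : bop X Y)
    (f : dual_space X) : `|G| = 1 -> Gdelta (norm_additive G f).
Proof.
move=> G1.
pose U n : set (weak_star Y) :=
  \bigcup_(p in [set p : K * X | `|p.1| = 1 /\ `|p.2| <= 1])
  [set k : weak_star Y | 1 + rnorm f - n.+1%:R^-1 - re (p.1 * f p.2) <
     re ((k : dual_space Y) (G p.2))].
exists (fun n => (\val : ext_dual_ball Y -> weak_star Y) @^-1` U n).
  move=> n; exists (U n) => //; apply: bigcup_open => p _.
  exact: open_weak_star_halfspace.
have f0 : 0 < 1 + rnorm f by rewrite ltr_pwDl // rnorm_ge0.
apply/seteqP; split => g.
  move=> /= ga n _ /=.
  have n0 : 0 < n.+1%:R^-1 :> R by rewrite invr_gt0.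
  have [_ [w w1 <-]] := sup_eq_gt ga f0 n0.
  rewrite [ltRHS]rnorm_bopE => /sup_gt[|_ [x x1 <-]]; first exact: (bop_has_sup _).1.
  set h : dual_space X := adjoint G _ + _.
  have hE u : re (h u) = re ((\val g : dual_space Y) (G u)) + re (w * f u).
    by rewrite -re_partD.
  have [v v1 vh] := rotate_re (h x); rewrite -vh => hx.
  exists (w, v *: x); first by split => //=; rewrite normrZ v1 mul1r.
  rewrite /= ltrBlDr; apply: lt_le_trans hx _.
  by rewrite -[v * h x]/(v *: (h x : K^o)) -linearZ hE.
move=> gU; rewrite /norm_additive /=.
have g1 : `|(\val g : dual_space Y)| <= 1 by have [] := set_mem (valP g).
apply: sup_eq => [_ [w w1 <-]|e e0].
  apply: le_trans (rnormD _ _) _; rewrite rnorm_unitZ // lerD2r -norm_le1E.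
  exact: adjoint_ball.
have [n ne] := natSinv_lt e0.
have [[w x] /= [w1 x1] gx] := gU n I.
exists (rnorm (adjoint G (\val g) + w *: f)); first by exists w.
apply: lt_trans (_ : 1 + rnorm f - n.+1%:R^-1 < _).
  by rewrite ltrD2l ltrN2.
rewrite [ltRHS]rnorm_bopE; apply: lt_le_trans (le_opnorm_ball _ x1).
apply: lt_le_trans (re_part_le_norm _).
rewrite -[(_ + _ : dual_space X) x]/((\val g : dual_space Y) (G x) + w * f x).
by rewrite re_partD -ltrBlDr.
Qed.

(** A neighbourhood of an extreme point contains a slice given by some [b]. An extreme functional
    norming a suitable perturbation [z] of [b] stays in that slice and is norm-additive. *)
Lemma norm_additive_dense (X : normedModType K) (Y : completeNormedModType K)
    (G : bop X Y) (f : dual_space X) :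
  `|G| = 1 -> norming_triples G -> dense (norm_additive G f).
Proof.
move=> G1 Gt O [g0 Og0] [W oW WO]; rewrite -WO in Og0 *.
have [b [e [e0 bW]]] := extreme_slice (set_mem (valP g0)) oW Og0.
have e3 : 0 < e / 3 by lra.
have [z zb zP] := norming_perturbation G1 f b Gt e3.
have [g gext gz] := extreme_norming z.
have g1 : `|g| <= 1 by case: gext.
exists (exist _ g (mem_set gext) : ext_dual_ball Y); split.
  rewrite /=; apply: bW => //.
  have := re_dual_ball_le (z - b) g1.
  rewrite linearB re_partD re_partN gz.
  have := ler_rnormB b (z - b); rewrite subrKC.
  by lra.
rewrite /norm_additive /=.
apply: sup_eq => [_ [w w1 <-]|d d0].
  apply: le_trans (rnormD _ _) _; rewrite rnorm_unitZ // lerD2r -norm_le1E.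
  exact: adjoint_ball.
have d2 : 0 < d / 2 by lra.
have [x [x1 fx gx]] := zP g g1 gz _ d2.
have [w w1 wf] := rotate_re (f x).
exists (rnorm (adjoint G g + w *: f)); first by exists w.
rewrite [ltRHS]rnorm_bopE; apply: lt_le_trans (le_opnorm_ball _ x1).
apply: lt_le_trans (re_part_le_norm _).
rewrite -[(_ + _ : dual_space X) x]/(g (G x) + w * f x).
by rewrite re_partD wf; lra.
Qed.

(** Some extreme functional norms [y], so the weak-star open set of those nearly norming [y] is
    nonempty and contains a norm-additive one. *)
Lemma dense_norm_additive_triples (X Y : normedModType K) (G : bop X Y) :
  `|G| = 1 -> (forall f, dense (norm_additive G f)) -> norming_triples G.
Proof.
move=> G1 Gd f y e e0.
have [g0 g0ext g0y] := extreme_norming y.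
pose W := [set k : weak_star Y | rnorm y - e < re ((k : dual_space Y) y)].
have [||g [/= gy ga]] := Gd f ((\val : ext_dual_ball Y -> weak_star Y) @^-1` W).
- exists (exist _ g0 (mem_set g0ext)); rewrite /W /= g0y.
  by rewrite ltrBlDr ltrDl.
- by exists W => //; exact: open_weak_star_halfspace.
have g1 : `|(\val g : dual_space Y)| <= 1 by have [] := set_mem (valP g).
have f0 : 0 < 1 + rnorm f by rewrite ltr_pwDl // rnorm_ge0.
have [_ [w w1 <-] wf] := sup_eq_gt ga f0 e0.
exact: (norm_adjoint_triples G1 g1 w1 gy wf).
Qed.

End norm_additive_functionals.

(** * The cycle of implications, each passing through [norming_triples] *)

Theorem theorem3p6 (R : realType) (cplx : bool)
    (X Y : completeNormedModType (scalar_field R cplx)) (G : bop X Y)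
    (B : set X) (A : set (dual_space Y)) :
  `|G| = 1 ->
  B `<=` unit_ball X ->
  unit_ball X = closure (convex_hull B) ->
  A `<=` unit_ball (dual_space Y) ->
  closure (convex_hull A : set (weak_star Y)) = unit_ball (dual_space Y) ->
  [<->
    (* (i) *)
    alternative_daugavet G;
    (* (ii) *)
    forall S : set X, is_slice B S -> spear_set (G @` S);
    (* (ii-star) *)
    forall S : set (dual_space Y), is_weak_star_slice A S ->
      spear_set (adjoint G @` S);
    (* (iii) *)
    forall (y0 : Y) (e : R), unit_sphere Y y0 -> 0 < e ->
      unit_ball X = closure (convex_hull
        [set x | B x /\ 2 - e < sup [set rnorm (G x + w *: y0) | w in unimodular]]);
    (* (iv) *)
    forall f0 : dual_space X, dense (norm_additive G f0) /\ Gdelta (norm_additive G f0)].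
Proof.
move=> G1 B1 B_hull A1 A_hull; tfae.
- by move=> /(alternative_daugavet_triples G1)/(triples_spear_slices G1 B1 B_hull).
- move=> /(spear_slices_triples G1 B1 B_hull).
  exact: (triples_spear_weak_star_slices G1 A1 A_hull).
(* The hull condition is derived from the spear property of slices of [B], recovered here through
   the triples. *)
- move=> /(spear_weak_star_slices_triples G1 A1 A_hull).
  move=> /(triples_spear_slices G1 B1 B_hull).
  exact: (spear_slices_hull G1 B1 B_hull).
- move=> /(hull_triples G1 B1) Gt f0; split; last exact: norm_additive_Gdelta.
  exact: norm_additive_dense.
- move=> Gd; apply: (triples_alternative_daugavet G1).
  by apply: dense_norm_additive_triples => // f; have [] := Gd f.
Qed.
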